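(* Let $G$ be a finite simple graph. Then the Hom complex $\mathrm{Hom}(G,K_n)$ is a PL manifold for all $n\geq \chi(G)$ if and only if $G$ is the complement of the $1$-skeleton of a flag simplicial PL sphere.
   Context: Graphs are finite and simple (no loops, no parallel edges); $K_n$ is the complete graph on $\{1,\dots,n\}$, and $\chi(G)$ is the chromatic number of $G$. Hom complex: for graphs $G,H$, $\mathrm{Hom}(G,H)$ is the subcomplex of the direct product $\prod_{x\in V(G)}\Delta^{V(H)}$ (where $\Delta^{V(H)}$ is the simplex with vertex set $V(H)$, and the cells of the product are products of simplices, with the product topology) whose non-empty cells are the products $\prod_{x\in V(G)}\eta(x)$ indexed by functions $\eta:V(G)\to 2^{V(H)}\setminus\{\emptyset\}$ such that whenever $\{u,v\}\in E(G)$, every $a\in\eta(u)$ and $b\in\eta(v)$ satisfy $\{a,b\}\in E(H)$. The cell $\eta$ is a face of the cell $\eta'$ iff $\eta(x)\subseteq\eta'(x)$ for all $x\in V(G)$. Its vertices are the graph homomorphisms $G\to H$. Link: the link of a vertex $v$ in $\mathrm{Hom}(G,H)$ is the cell complex whose face poset is the poset of cells strictly containing $v$; it is a simplicial complex. A PL $d$-sphere is a finite simplicial complex that is PL homeomorphic to the boundary of the standard $(d+1)$-simplex; the complex $\{\emptyset\}$ is regarded as the $(-1)$-dimensional PL sphere. $\mathrm{Hom}(G,K_n)$ is a PL $d$-manifold iff every vertex link is a PL $(d-1)$-sphere (so manifolds are without boundary, and connectedness is not required). A simplicial complex $K$ is a flag simplicial complex if every set of vertices of $K$ that forms a clique in the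 $1$-skeleton of $K$ spans a simplex of $K$. A flag simplicial PL sphere is a flag simplicial complex that is a PL sphere (of some dimension). The $1$-skeleton is regarded as a graph, and the complement of a graph is the graph on the same vertex set whose edges are exactly the non-edges. *)

(* Defs.v *)
From mathcomp Require Import all_boot all_order all_algebra reals.
Set Implicit Arguments.
Unset Strict Implicit.
Unset Printing Implicit Defensive.
Import Order.TTheory GRing.Theory Num.Theory.
Local Open Scope ring_scope.

Record sgraph := SGraph {
  vertex :> finType;
  adj : rel vertex;
  adj_sym : symmetric adj;
  adj_irr : irreflexive adj }.

Definition complete_rel (n : nat) : rel 'I_n := fun i j => i != j.

Lemma complete_sym n : symmetric (@complete_rel n).
Proof. by move=> i j; rewrite /complete_rel eq_sym. Qed.

Lemma complete_irr n : irreflexive (@complete_rel n).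
Proof. by move=> i; rewrite /complete_rel eqxx. Qed.

Definition complete (n : nat) : sgraph :=
  SGraph (@complete_sym n) (@complete_irr n).

Definition compl_rel (G : sgraph) : rel G := fun x y => (x != y) && ~~ adj x y.

Lemma compl_sym G : symmetric (@compl_rel G).
Proof. by move=> x y; rewrite /compl_rel eq_sym adj_sym. Qed.

Lemma compl_irr G : irreflexive (@compl_rel G).
Proof. by move=> x; rewrite /compl_rel eqxx. Qed.

Definition complement (G : sgraph) : sgraph :=
  SGraph (@compl_sym G) (@compl_irr G).

Definition graph_iso (G H : sgraph) : Prop :=
  exists2 f : G -> H, bijective f & forall x y, adj (f x) (f y) = adj x y.

Definition is_hom (G H : sgraph) (f : {ffun G -> H}) : bool :=
  [forall x, forall y, adj x y ==> adj (f x) (f y)].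

Definition colorable (G : sgraph) (n : nat) : bool :=
  [exists f : {ffun G -> complete n}, is_hom f].

Lemma colorable_ex (G : sgraph) : exists n, colorable G n.
Proof.
exists #|G|; apply/existsP; exists [ffun x => enum_rank x].
apply/forallP=> x; apply/forallP=> y; apply/implyP=> xy.
rewrite /= /complete_rel !ffunE; apply/eqP=> /enum_rank_inj exy.
by rewrite exy adj_irr in xy.
Qed.

Definition chromatic_number (G : sgraph) : nat := ex_minn (colorable_ex G).

(* The empty face always belongs to a complex. The elements v of V with
   [set v] not a face are not vertices of the complex. *)
Record complex (V : finType) := Complex {
  faces :> {set {set V}};
  face0 : set0 \in faces;
  face_sub : forall s t : {set V}, t \in faces -> s \subset t -> s \in faces }.

Lemma full_face0 (V : finType) (s : {set V}) : set0 \in powerset s.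
Proof. by rewrite inE sub0set. Qed.

Lemma full_face_sub (V : finType) (s a b : {set V}) :
  b \in powerset s -> a \subset b -> a \in powerset s.
Proof. by rewrite !inE => bs ab; apply: subset_trans ab bs. Qed.

Definition simplex (V : finType) (s : {set V}) : complex V :=
  Complex (full_face0 s) (@full_face_sub V s).

Lemma bd_face0 m : set0 \in [set s : {set 'I_m.+1} | s \proper [set: 'I_m.+1]].
Proof. by rewrite inE proper0; apply/set0Pn; exists ord0. Qed.

Lemma bd_face_sub m (s t : {set 'I_m.+1}) :
  t \in [set s : {set 'I_m.+1} | s \proper [set: 'I_m.+1]] -> s \subset t ->
  s \in [set s : {set 'I_m.+1} | s \proper [set: 'I_m.+1]].
Proof. by rewrite !inE => tp st; apply: sub_proper_trans st tp. Qed.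

(* The boundary of the standard m-simplex; for m = 0 it is {set0}. *)
Definition simplex_boundary (m : nat) : complex 'I_m.+1 :=
  Complex (bd_face0 m) (@bd_face_sub m).

Definition flag (V : finType) (K : complex V) : Prop :=
  forall s : {set V},
    (forall x, x \in s -> [set x] \in K) ->
    (forall x y, x \in s -> y \in s -> x != y -> [set x; y] \in K) ->
    s \in K.

Definition skeleton_rel (V : finType) (K : complex V) :
    rel {x : V | [set x] \in K} :=
  fun x y => (x != y) && ([set val x; val y] \in K).

Lemma skeleton_sym V (K : complex V) : symmetric (@skeleton_rel V K).
Proof. by move=> x y; rewrite /skeleton_rel eq_sym setUC. Qed.

Lemma skeleton_irr V (K : complex V) : irreflexive (@skeleton_rel V K).
Proof. by move=> x; rewrite /skeleton_rel eqxx. Qed.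

Definition skeleton1 (V : finType) (K : complex V) : sgraph :=
  SGraph (@skeleton_sym V K) (@skeleton_irr V K).

(* The geometric realization |K|, in barycentric coordinates in R^V. *)
Definition realization (R : realType) (V : finType) (K : complex V) :
    pred {ffun V -> R} :=
  fun t => [&& [forall v, 0 <= t v], \sum_v t v == 1
             & [set v | t v != 0] \in K].

(* The point of R^V with barycentric coordinates t with respect to the
   points p w. *)
Definition barycenter (R : realType) (W V : finType)
    (p : W -> {ffun V -> R}) (t : {ffun W -> R}) : {ffun V -> R} :=
  [ffun v => \sum_w t w * p w v].

(* (K', p) is a linear subdivision of K: the vertices w of the complex K' are
   placed at points p w of |K|. Injectivity of the linear extension of p
   on |K'| says that the vertices of each simplex are affinely independent and
   that simplices meet in common faces; surjectivity says that they cover |K|. *)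
Definition is_subdivision (R : realType) (V W : finType) (K : complex V)
    (K' : complex W) (p : W -> {ffun V -> R}) : Prop :=
  [/\ forall s, s \in K' -> exists2 s', s' \in K &
        forall t, t \in @realization R W (simplex s) ->
          barycenter p t \in @realization R V (simplex s'),
      {in @realization R W K' &, injective (barycenter p)}
    & forall y, y \in @realization R V K ->
        exists2 t, t \in @realization R W K' & barycenter p t = y].

(* f maps |K| to |L| and is linear on every simplex of a subdivision of K.
   Values of f outside |K| are irrelevant. *)
Definition PL_map (R : realType) (V W : finType) (K : complex V)
    (L : complex W) (f : {ffun V -> R} -> {ffun W -> R}) : Prop :=
  (forall x, x \in @realization R V K -> f x \in @realization R W L) /\
  exists (U : finType) (K' : complex U) (p : U -> {ffun V -> R}),
    is_subdivision K K' p /\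
    forall t, t \in @realization R U K' ->
      f (barycenter p t) = barycenter (fun u => f (p u)) t.

(* PL maps are continuous, so mutually inverse PL maps are homeomorphisms. *)
Definition PL_homeomorphic (R : realType) (V W : finType) (K : complex V)
    (L : complex W) : Prop :=
  exists (f : {ffun V -> R} -> {ffun W -> R})
         (g : {ffun W -> R} -> {ffun V -> R}),
    [/\ PL_map K L f, PL_map L K g,
        {in @realization R V K, cancel f g}
      & {in @realization R W L, cancel g f}].

(* PL spheres of dimension m - 1: the shift makes the dimension -1 available,
   and K is a PL (-1)-sphere exactly when its only face is the empty one. *)
Definition PL_sphere_pred (R : realType) (m : nat) (V : finType)
    (K : complex V) : Prop :=
  PL_homeomorphic R K (simplex_boundary m).

Definition PL_sphere (R : realType) (V : finType) (K : complex V) : Prop :=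
  exists m, PL_sphere_pred R m K.

(* The non-empty cells of Hom(G, H): eta stands for the product of the
   simplices spanned by the sets eta x. *)
Definition Hom (G H : sgraph) : {set {ffun G -> {set H}}} :=
  [set eta : {ffun G -> {set H}} |
    [forall x, eta x != set0] &&
    [forall u, forall v, adj u v ==>
      [forall a in eta u, forall b in eta v, adj a b]]].

Definition cell_le (G H : sgraph) (eta eta' : {ffun G -> {set H}}) : bool :=
  [forall x, eta x \subset eta' x].

Definition cell_lt (G H : sgraph) (eta eta' : {ffun G -> {set H}}) : bool :=
  cell_le eta eta' && (eta != eta').

Definition vertex_cell (G H : sgraph) (f : {ffun G -> H}) :
    {ffun G -> {set H}} := [ffun x => [set f x]].

(* The simplicial complex L is (a copy of) the link of f in Hom(G, H): F is an
   isomorphism from the poset of non-empty faces of L to the poset of cells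
   strictly containing f. Such an L is unique up to simplicial isomorphism. *)
Definition is_link (G H : sgraph) (f : {ffun G -> H}) (W : finType)
    (L : complex W) : Prop :=
  exists F : {set W} -> {ffun G -> {set H}},
    [/\ forall s, s \in L -> s != set0 ->
          F s \in Hom G H /\ cell_lt (vertex_cell f) (F s),
        forall s t, s \in L -> s != set0 -> t \in L -> t != set0 ->
          cell_le (F s) (F t) = (s \subset t)
      & forall eta, eta \in Hom G H -> cell_lt (vertex_cell f) eta ->
          exists s, [/\ s \in L, s != set0 & F s = eta]].

Definition Hom_PL_manifold_dim (R : realType) (d : nat) (G H : sgraph) :
    Prop :=
  forall f : {ffun G -> H}, is_hom f ->
    exists (W : finType) (L : complex W), is_link f L /\ PL_sphere_pred R d L.

Definition Hom_PL_manifold (R : realType) (G H : sgraph) : Prop :=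
  exists d, Hom_PL_manifold_dim R d G H.

(* Main.v *)
Require Import Defs.
From mathcomp Require Import all_boot all_order all_algebra reals.
From mathcomp Require boolp.
From mathcomp Require Import ring lra.
Set Implicit Arguments.
Unset Strict Implicit.
Unset Printing Implicit Defensive.
Import Order.TTheory GRing.Theory Num.Theory.
Local Open Scope ring_scope.

(** For a colouring [f] of [G] with [n] colours, a cell of Hom(G, K_n) that
    contains [f] is a choice, for each colour [i], of an independent set that
    contains the colour class of [i]; the choices for different colours do not
    interact. So the link of [f] is the join, over the colours, of the links of
    the colour classes in the complex Ind(G) of independent sets
    ([hom_link_is_link]). Ind(G) is flag, its 1-skeleton is the complement of
    [G], and it is, up to isomorphism, the only flag complex with that
    1-skeleton. The theorem thus says that all these joins are PL spheres of
    one dimension if and only if Ind(G) is a PL sphere.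

    If Ind(G) is a PL sphere, then so are the links of its faces
    ([sphere_link]), and a join of PL spheres is a PL sphere
    ([sphere_bigjoin]). The dimension of the join depends only on [n], on [G]
    and on the dimension of Ind(G), because the sizes of the colour classes add
    up to the number of vertices of [G]. Conversely, let the last colour be
    unused by [f]. The link of [f] is then X * Ind(G), where X is the join over
    the other colours, and Ind(G) is the link in it of any maximal face of X;
    so it is a link of a face of a PL sphere ([sphere_Ind_of_hom_link]).

    It remains to prove the two facts on links and joins. A segment in |L|, in
    barycentric coordinates, lies in one simplex of L: the support of an
    interior point contains the supports of the end points. Hence a map that is
    linear on the simplices of a subdivision of K and takes values in |L| maps
    each of these simplices into a simplex of L, and K and L are PL homeomorphic
    exactly when they have a common subdivision ([PL_homeomorphicP]). Joins of
    subdivisions are subdivisions, and a join of two simplex boundaries is a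
    stellar subdivision of a simplex boundary ([two_part_subd]), which settles
    joins.

    For links, let P be a common subdivision of K and of the boundary of a
    simplex, by maps p and q, and let w be the vertex of P that lies at a vertex
    v of K. Radial projection from v makes link(w, P) a subdivision of
    link(v, K) ([subd_link_vertex]). On the other side q(w) need not be a
    vertex. After refining P, it also subdivides the stellar subdivision of the
    simplex boundary at q(w) ([subd_stellar_vertex]), where q(w) becomes a
    vertex whose link is again a join of two simplex boundaries. So link(v, K)
    has a common subdivision with the boundary of a simplex of one dimension
    less. The refinement needs only the starring of edges: it has to make
    finitely many linear functions keep a weak sign on each simplex. *)

(** * Cones over complexes, subdivisions and PL homeomorphism *)

Section Cones.
Variable R : realType.
Local Notation point V := {ffun V -> R}.

Definition supp (V : finType) (t : point V) : {set V} := [set v | t v != 0].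

Definition mass (V : finType) (t : point V) : R := \sum_v t v.

Definition scale (V : finType) (a : R) (t : point V) : point V :=
  [ffun v => a * t v].
Local Notation "a ** t" := (scale a t) (at level 40, left associativity).

Definition delta (V : finType) (v : V) : point V := [ffun u => (u == v)%:R].

(** Working with all nonnegative vectors supported on a face, rather than with
    those of mass 1, avoids normalizations: joins, stars and radial projections
    become sums of vectors. *)
Definition cone (V : finType) (K : complex V) : pred (point V) :=
  fun t => [forall v, 0 <= t v] && (supp t \in K).

Lemma coneP (V : finType) (K : complex V) (t : point V) :
  reflect ((forall v, 0 <= t v) /\ supp t \in K) (t \in cone K).
Proof. by apply: (iffP andP) => -[/forallP]. Qed.

Lemma cone_ge0 (V : finType) (K : complex V) (t : point V) v :
  t \in cone K -> 0 <= t v.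
Proof. by case/coneP. Qed.

Lemma realizationE (V : finType) (K : complex V) (t : point V) :
  (t \in @realization R V K) = (t \in cone K) && (mass t == 1).
Proof. by rewrite !unfold_in /realization /cone /mass /supp andbA andbAC. Qed.

Lemma in_supp (V : finType) (t : point V) v : (v \in supp t) = (t v != 0).
Proof. by rewrite inE. Qed.

Lemma supp0 (V : finType) (t : point V) v : v \notin supp t -> t v = 0.
Proof. by rewrite in_supp negbK => /eqP. Qed.

Lemma supp_vertex (V : finType) (K : complex V) (s : {set V}) v :
  s \in K -> v \in s -> [set v] \in K.
Proof. by move=> sK vs; apply: face_sub sK _; rewrite sub1set. Qed.

Lemma supp_delta (V : finType) (v : V) : supp (delta v) = [set v].
Proof.
by apply/setP=> u; rewrite !inE ffunE pnatr_eq0 eqb0 negbK.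
Qed.

Lemma sum_delta (V : finType) (v : V) (F : V -> R) :
  \sum_u (u == v)%:R * F u = F v.
Proof.
rewrite (bigD1 v) //= eqxx mul1r big1 ?addr0 // => u /negPf->.
by rewrite mul0r.
Qed.

Lemma mass_delta (V : finType) (v : V) : mass (delta v) = 1.
Proof.
rewrite -(sum_delta v (fun=> 1)); apply: eq_bigr => u _.
by rewrite ffunE mulr1.
Qed.

Lemma cone_delta (V : finType) (K : complex V) v :
  [set v] \in K -> delta v \in cone K.
Proof.
by move=> vK; apply/coneP; rewrite supp_delta; split=> // u;
  rewrite ffunE ler0n.
Qed.

Lemma mass_gt0 (V : finType) (t : point V) :
  (forall v, 0 <= t v) -> t != 0 -> 0 < mass t.
Proof.
move=> t0 tN0; rewrite lt_def sumr_ge0 // andbT.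
apply: contra tN0 => /eqP/psumr_eq0P e; apply/eqP/ffunP => v.
by rewrite e // ffunE.
Qed.

Lemma mass_supp (V : finType) (t : point V) :
  mass t != 0 -> exists v, v \in supp t.
Proof.
move=> m; apply/set0Pn; apply: contra m => /eqP s0.
by apply/eqP/big1 => v _; apply: supp0; rewrite s0 inE.
Qed.

Lemma scaleA (V : finType) a b (t : point V) : a ** (b ** t) = (a * b) ** t.
Proof. by apply/ffunP=> v; rewrite !ffunE mulrA. Qed.

Lemma scale1 (V : finType) (t : point V) : 1 ** t = t.
Proof. by apply/ffunP=> v; rewrite !ffunE mul1r. Qed.

Lemma massZ (V : finType) a (t : point V) : mass (a ** t) = a * mass t.
Proof. by rewrite /mass mulr_sumr; apply: eq_bigr => v _; rewrite ffunE. Qed.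

Lemma suppZ (V : finType) a (t : point V) : a != 0 -> supp (a ** t) = supp t.
Proof.
by move=> a0; apply/setP=> v; rewrite !inE ffunE mulf_eq0 (negPf a0).
Qed.

Lemma coneZ (V : finType) (K : complex V) a (t : point V) :
  0 < a -> t \in cone K -> a ** t \in cone K.
Proof.
move=> a0 /coneP[t0 tK]; apply/coneP; rewrite suppZ ?gt_eqF //; split=> // v.
by rewrite ffunE mulr_ge0 // ltW.
Qed.

Lemma cone0 (V : finType) (K : complex V) : (0 : point V) \in cone K.
Proof.
apply/coneP; split=> [v|]; first by rewrite ffunE.
rewrite (_ : supp _ = set0) ?face0 //.
by apply/setP=> v; rewrite !inE ffunE eqxx.
Qed.

Lemma delta_of_supp (V : finType) (v : V) (t : point V) :
  mass t = 1 -> supp t \subset [set v] -> t = delta v.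
Proof.
move=> m s; have t0 u : u != v -> t u = 0.
  move=> uv; apply: supp0; apply/negP => /(subsetP s).
  by rewrite inE (negPf uv).
apply/ffunP=> u; rewrite ffunE; case: eqP => [->|/eqP/t0 //].
by rewrite -m /mass (bigD1 v) //= big1 ?addr0.
Qed.

Section Bary.
Variables W V : finType.
Implicit Types (p q : W -> point V) (t : point W).

Lemma baryE p t v : barycenter p t v = \sum_w t w * p w v.
Proof. by rewrite ffunE. Qed.

Lemma bary_delta p w : barycenter p (delta w) = p w.
Proof.
apply/ffunP=> v; rewrite baryE -[RHS](sum_delta w (fun u => p u v)).
by apply: eq_bigr => u _; rewrite ffunE.
Qed.

Lemma eq_bary p q t :
  (forall w, w \in supp t -> p w = q w) -> barycenter p t = barycenter q t.
Proof.
move=> e; apply/ffunP=> v; rewrite !baryE; apply: eq_bigr => w _.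
by have [/e->//|/supp0->] := boolP (w \in supp t); rewrite !mul0r.
Qed.

Lemma baryZ p a t : barycenter p (a ** t) = a ** barycenter p t.
Proof.
apply/ffunP=> v; rewrite baryE [RHS]ffunE baryE mulr_sumr.
by apply: eq_bigr => w _; rewrite ffunE -mulrA.
Qed.

Lemma bary0 p : barycenter p 0 = 0.
Proof.
by apply/ffunP=> v; rewrite baryE ffunE big1 // => w _; rewrite ffunE mul0r.
Qed.

Lemma mass_bary p t : (forall w, w \in supp t -> mass (p w) = 1) ->
  mass (barycenter p t) = mass t.
Proof.
move=> m; rewrite /mass.
under eq_bigr => v _ do rewrite baryE.
rewrite exchange_big; apply: eq_bigr => w _ /=; rewrite -mulr_sumr.
by have [/m e|/supp0->] := boolP (w \in supp t);
  rewrite ?mul0r // [X in _ * X]e mulr1.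
Qed.

Lemma bary_ge0 p t : (forall w, 0 <= t w) ->
    (forall w, w \in supp t -> forall v, 0 <= p w v) ->
  forall v, 0 <= barycenter p t v.
Proof.
move=> t0 p0 v; rewrite baryE; apply: sumr_ge0 => w _.
have [wt|/supp0->] := boolP (w \in supp t); last by rewrite mul0r.
by rewrite mulr_ge0 ?p0.
Qed.

Lemma supp_bary p t : (forall w, 0 <= t w) ->
    (forall w, w \in supp t -> forall v, 0 <= p w v) ->
  supp (barycenter p t) = \bigcup_(w in supp t) supp (p w).
Proof.
move=> t0 p0; apply/setP=> v; rewrite in_supp baryE psumr_neq0; last first.
  move=> w _; have [wt|/supp0->] := boolP (w \in supp t).
    by rewrite mulr_ge0 ?p0.
  by rewrite mul0r.
apply/hasP/bigcupP => [[w _]|[w wt wv]].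
  rewrite andTb => /lt0r_neq0; rewrite mulf_eq0 negb_or => /andP[a b].
  by exists w; rewrite in_supp.
exists w; first by rewrite mem_index_enum.
by rewrite andTb lt_def mulf_neq0 -?in_supp // mulr_ge0 ?p0.
Qed.

End Bary.

Lemma bary_bary (U W V : finType) (p : W -> point V) (q : U -> point W) t :
  barycenter p (barycenter q t) = barycenter (fun u => barycenter p (q u)) t.
Proof.
apply/ffunP=> v; rewrite !baryE.
under eq_bigr => w _ do rewrite baryE mulr_suml.
rewrite exchange_big; apply: eq_bigr => u _ /=; rewrite baryE mulr_sumr.
by apply: eq_bigr => w _; rewrite mulrA.
Qed.

Lemma bary_id (V : finType) (t : point V) : barycenter (@delta V) t = t.
Proof.
apply/ffunP=> v; rewrite baryE -[RHS](sum_delta v t).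
by apply: eq_bigr => u _; rewrite ffunE mulrC eq_sym.
Qed.

(** The homogeneous form of a linear subdivision. That simplices go into
    simplices is not part of it: see [subd_face]. *)
Definition subdivides (V U : finType) (K : complex V) (P : complex U)
    (p : U -> point V) : Prop :=
  [/\ forall u, [set u] \in P -> mass (p u) = 1,
      forall t, t \in cone P -> barycenter p t \in cone K,
      {in cone P &, injective (barycenter p)}
    & forall y, y \in cone K -> exists2 t, t \in cone P & barycenter p t = y].

Section Subdivision.
Variables (V U : finType) (K : complex V) (P : complex U) (p : U -> point V).
Hypothesis KP : subdivides K P p.

Lemma subd_mass1 u : [set u] \in P -> mass (p u) = 1.
Proof. by case: KP => m _ _ _ /m. Qed.

Lemma subd_cone t : t \in cone P -> barycenter p t \in cone K.
Proof. by case: KP => _ c _ _ /c. Qed.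

Lemma subd_inj : {in cone P &, injective (barycenter p)}.
Proof. by case: KP. Qed.

Lemma subd_surj y :
  y \in cone K -> exists2 t, t \in cone P & barycenter p t = y.
Proof. by case: KP => _ _ _ s /s. Qed.

Lemma subd_vertex u : [set u] \in P -> p u \in cone K.
Proof. by move=> /cone_delta/subd_cone; rewrite bary_delta. Qed.

Lemma subd_ge0 u v : [set u] \in P -> 0 <= p u v.
Proof. by move=> /subd_vertex/cone_ge0. Qed.

Lemma subd_mass t : t \in cone P -> mass (barycenter p t) = mass t.
Proof.
case/coneP => _ tP; apply: mass_bary => u ut.
exact/subd_mass1/(supp_vertex tP).
Qed.

(** The image of the barycenter of [s] has the union of the supports of the
    images of the vertices of [s] as its support. This is why a simplex of [P],
    mapped linearly into |K|, stays in one simplex of [K]. *)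
Lemma subd_face s : s \in P -> \bigcup_(u in s) supp (p u) \in K.
Proof.
move=> sP; pose t : point U := [ffun u => (u \in s)%:R].
have st : supp t = s.
  by apply/setP=> u; rewrite inE ffunE pnatr_eq0 eqb0 negbK.
have t0 u : 0 <= t u by rewrite ffunE ler0n.
have tP : t \in cone P by apply/coneP; rewrite st.
have /coneP[_] := subd_cone tP.
by rewrite supp_bary ?st // => u us v; apply/subd_ge0/(supp_vertex sP).
Qed.

Lemma subd_vertex_inj u u' :
  [set u] \in P -> [set u'] \in P -> p u = p u' -> u = u'.
Proof.
move=> uP u'P e; have : delta u = delta u'.
  by apply: subd_inj; rewrite ?cone_delta // !bary_delta.
move/(congr1 (fun t : point U => supp t)); rewrite !supp_delta.
by move/set1_inj.
Qed.

(** A vertex of [K] is an extreme point of each simplex, so the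
    vertices of [P] whose simplex contains its preimage are all placed at it. *)
Lemma subd_over_vertex v : [set v] \in K ->
  exists2 u, [set u] \in P & p u = delta v.
Proof.
move=> vK; have [t tP e] := subd_surj (cone_delta vK).
have [t0 sP] := coneP _ _ tP.
have [u ut] : exists u, u \in supp t.
  by apply: mass_supp; rewrite -subd_mass // e mass_delta oner_eq0.
have uP := supp_vertex sP ut; exists u => //.
apply: delta_of_supp; first exact: subd_mass1.
rewrite -supp_delta -e supp_bary //; first exact: bigcup_sup ut.
by move=> w wt v'; apply/subd_ge0/(supp_vertex sP).
Qed.

End Subdivision.

Lemma subd_refl (V : finType) (K : complex V) : subdivides K K (@delta V).
Proof.
split=> [u _|t|t t' _ _|y]; rewrite ?mass_delta ?bary_id //.
by exists y; rewrite ?bary_id.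
Qed.

Lemma subd_trans (V U W : finType) (K : complex V) (P : complex U)
    (Q : complex W) p q :
  subdivides K P p -> subdivides P Q q ->
  subdivides K Q (fun w => barycenter p (q w)).
Proof.
move=> KP PQ; split=> [w wQ|t tQ|t t' tQ t'Q|y].
- by rewrite (subd_mass KP) ?(subd_mass1 PQ) ?(subd_vertex PQ).
- by rewrite -bary_bary; apply/(subd_cone KP)/(subd_cone PQ).
- rewrite -!bary_bary => /(subd_inj KP)/(subd_inj PQ)->;
    by rewrite ?(subd_cone PQ).
- case/(subd_surj KP) => t /(subd_surj PQ)[t' t'Q <-] <-.
  by exists t'; rewrite -?bary_bary.
Qed.

Definition real_bijection (V U : finType) (K : complex V) (P : complex U)
    (p : U -> point V) : Prop :=
  [/\ forall t, t \in @realization R _ P ->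
        barycenter p t \in @realization R _ K,
      {in @realization R _ P &, injective (barycenter p)}
    & forall y, y \in @realization R _ K ->
        exists2 t, t \in @realization R _ P & barycenter p t = y].

(** Nonnegative vectors are rescaled to mass 1. *)
Lemma real_bijection_subd (V U : finType) (K : complex V) (P : complex U)
    (p : U -> point V) : real_bijection K P p -> subdivides K P p.
Proof.
case=> c i s.
have norm (W : finType) (L : complex W) (t : point W) :
    t \in cone L -> t != 0 -> (mass t)^-1 ** t \in @realization R _ L.
  move=> tL tN0; have m0 : 0 < mass t.
    by apply: mass_gt0 => // v; apply: cone_ge0 tL.
  rewrite realizationE massZ mulVf ?(gt_eqF m0) // eqxx andbT.
  by apply: coneZ; rewrite // invr_gt0.
have m1 u : [set u] \in P -> mass (p u) = 1.
  move=> uP; have : delta u \in @realization R _ P.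
    by rewrite realizationE cone_delta // mass_delta eqxx.
  by move/c; rewrite bary_delta realizationE => /andP[_ /eqP].
have mP t : t \in cone P -> mass (barycenter p t) = mass t.
  case/coneP => _ tP; apply: mass_bary => u ut.
  exact/m1/(supp_vertex tP).
have eq0 (t t' : point U) : t \in cone P -> t' \in cone P -> 
    barycenter p t = barycenter p t' -> t = 0 -> t' = 0.
  move=> tP t'P e t0; apply/eqP; apply: contraT => /mass_gt0.
  have t'0 v : 0 <= t' v by apply: cone_ge0 t'P.
  move/(_ t'0); rewrite -mP // -e mP // t0 /mass big1 ?ltxx // => u _.
  by rewrite ffunE.
have back (W : finType) (L : complex W) (y : point W) m :
    0 < m -> m^-1 ** y \in cone L -> y \in cone L.
  move=> m0 /(coneZ m0); by rewrite scaleA mulfV ?gt_eqF // scale1.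
split=> // [t tP|t t' tP t'P e|y yK].
- have [->|tN0] := eqVneq t 0; first by rewrite bary0 cone0.
  have /c := norm _ _ _ tP tN0; rewrite baryZ realizationE => /andP[+ _].
  by apply/back/mass_gt0 => // v; apply: cone_ge0 tP.
- have [t0|tN0] := eqVneq t 0; first by rewrite (eq0 _ _ tP t'P e t0).
  have t'N0 : t' != 0.
    by apply: contra tN0 => /eqP t'0; apply/eqP; apply: (eq0 t').
  have em : mass t = mass t' by rewrite -!mP ?e.
  have m0 : (mass t')^-1 != 0.
    by rewrite invr_eq0 gt_eqF // mass_gt0 // => v; apply: cone_ge0 t'P.
  rewrite -[t]scale1 -[t']scale1 -(mulVf m0) -!scaleA; congr (_ ** _).
  by apply: i; rewrite ?norm //; [rewrite -em norm | rewrite !baryZ e].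
- have [->|yN0] := eqVneq y 0; first by exists 0; rewrite ?cone0 ?bary0.
  have m0 : 0 < mass y by apply: mass_gt0 => // v; apply: cone_ge0 yK.
  have [t + e] := s _ (norm _ _ _ yK yN0); rewrite realizationE => /andP[tP _].
  exists (mass y ** t); first by rewrite coneZ.
  by rewrite baryZ e scaleA mulfV ?gt_eqF // scale1.
Qed.

Lemma subd_real_bijection (V U : finType) (K : complex V) (P : complex U)
    (p : U -> point V) : subdivides K P p -> real_bijection K P p.
Proof.
move=> KP; split=> [t|t t'|y]; rewrite !realizationE.
- case/andP=> tP m; by rewrite (subd_cone KP) // (subd_mass KP).
- by case/andP=> tP _ /andP[t'P _] /(subd_inj KP)->.
- case/andP=> /(subd_surj KP)[t tP <-]; rewrite (subd_mass KP) // => m.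
  by exists t; rewrite ?realizationE ?tP.
Qed.

Lemma simplex_real (V : finType) (s : {set V}) (t : point V) :
  (t \in @realization R V (simplex s)) =
    [&& [forall v, 0 <= t v], supp t \subset s & mass t == 1].
Proof. by rewrite unfold_in /realization inE andbCA andbC -!andbA. Qed.

Lemma is_subdivisionP (V U : finType) (K : complex V) (P : complex U)
    (p : U -> point V) : is_subdivision K P p <-> real_bijection K P p.
Proof.
split=> [[f i s]|KP].
  split=> // t tP; have := tP.
  rewrite realizationE => /andP[/coneP[t0 sP] /eqP m].
  have [s' s'K /(_ t)] := f _ sP.
  rewrite !simplex_real subxx m eqxx andbT.
  have -> : [forall v, 0 <= t v] by apply/forallP.
  case/(_ isT)/and3P=> b0 bs bm; rewrite realizationE bm andbT; apply/coneP.
  by split; [exact/forallP | apply: face_sub s'K bs].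
have [c i s] := KP; split=> // s0 s0P.
have KP' := real_bijection_subd KP.
exists (\bigcup_(u in s0) supp (p u)); first exact: (subd_face KP').
move=> t; rewrite !simplex_real => /and3P[/forallP t0 ts m].
have pge u : u \in supp t -> forall v, 0 <= p u v.
  by move=> /(subsetP ts) us v; apply/(subd_ge0 KP')/(supp_vertex s0P).
rewrite (mass_bary (p := p)) => [|u /(subsetP ts) us]; last first.
  exact/(subd_mass1 KP')/(supp_vertex s0P).
rewrite m andbT; apply/andP; split; first by apply/forallP/bary_ge0.
rewrite supp_bary //; apply/bigcupsP => u ut.
by apply: bigcup_sup; apply: (subsetP ts).
Qed.

Definition PL_equiv (V W : finType) (K : complex V) (L : complex W) : Prop :=
  exists (U : finType) (P : complex U) (p : U -> point V) (q : U -> point W),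
    subdivides K P p /\ subdivides L P q.

(** If [f] is linear on the subdivision [(P, p)] of [K], then [(P, f o p)] is a
    subdivision of [L], by the remark on supports at [subd_face]. Conversely,
    two subdivisions [p] and [q] by one complex give the maps q o p^-1 and
    p o q^-1. *)
Lemma PL_homeomorphicP (V W : finType) (K : complex V) (L : complex W) :
  PL_homeomorphic R K L <-> PL_equiv K L.
Proof.
split=> [[f [g [[fK [U [P [p [/is_subdivisionP KP lin]]]]] [gL _] fg gf]]]|].
  exists U, P, p, (fun u => f (p u)); split; apply: real_bijection_subd => //.
  have [c i s] := KP; split=> [t tP|t t' tP t'P|y yL].
  - by rewrite -lin //; apply/fK/c.
  - rewrite -!lin // => /(congr1 g); rewrite !fg ?c //; exact: i.
  - have [t tP e] := s _ (gL _ yL); exists t => //.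
    by rewrite -lin // e gf.
case=> U [P [p [q [/subd_real_bijection KP /subd_real_bijection LP]]]].
have inv (X : finType) (M : complex X) (r : U -> point X) :
    real_bijection M P r -> exists F : point X -> point U,
    forall y, y \in @realization R _ M -> F y \in @realization R _ P /\
      barycenter r (F y) = y.
  case=> _ _ s; have /boolp.choice[F HF] : forall y, exists t,
      y \in @realization R _ M ->
      t \in @realization R _ P /\ barycenter r t = y.
    move=> y; case: (boolP (y \in @realization R _ M)) => [/s[t tP e]|_].
      by exists t.
    by exists 0.
  by exists F.
have [F HF] := inv _ _ _ KP; have [H HH] := inv _ _ _ LP.
have Fp t : t \in @realization R _ P -> F (barycenter p t) = t.
  move=> tP; case: KP => c i _; have [a b] := HF _ (c _ tP); exact: i.
have Hq t : t \in @realization R _ P -> H (barycenter q t) = t.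
  move=> tP; case: LP => c i _; have [a b] := HH _ (c _ tP); exact: i.
have lin (X Y : finType) (M : complex X) (r : U -> point X) (r' : U -> point Y)
    (F' : point X -> point U) : 
    (forall t, t \in @realization R _ P -> F' (barycenter r t) = t) ->
    forall t, t \in @realization R _ P ->
    barycenter r' (F' (barycenter r t)) =
    barycenter (fun u => barycenter r' (F' (r u))) t.
  move=> F'r t tP; rewrite F'r //; apply: eq_bary => u ut.
  rewrite -[r u]bary_delta F'r ?bary_delta //.
  rewrite realizationE mass_delta eqxx andbT.
  move: tP; rewrite realizationE => /andP[/coneP[_ sP] _].
  exact/cone_delta/(supp_vertex sP).
exists (fun y => barycenter q (F y)), (fun z => barycenter p (H z)).
have qF y : y \in @realization R _ K ->
    barycenter q (F y) \in @realization R _ L.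
  by case/HF => + _; case: LP => c _ _ /c.
have pH y : y \in @realization R _ L ->
    barycenter p (H y) \in @realization R _ K.
  by case/HH => + _; case: KP => c _ _ /c.
split.
- split=> //; exists U, P, p; split; first exact/is_subdivisionP.
  exact: (lin _ _ K).
- split=> //; exists U, P, q; split; first exact/is_subdivisionP.
  exact: (lin _ _ L).
- by move=> y /HF[a b]; rewrite Hq.
- by move=> y /HH[a b]; rewrite Fp.
Qed.

End Cones.

(** * Stellar subdivisions and links of vertices *)

Section Stellar.
Variable R : realType.
Local Notation point V := {ffun V -> R}.

Lemma big_option (V : finType) (F : option V -> R) :
  \sum_o F o = F None + \sum_v F (Some v).
Proof.
rewrite (bigD1 None) //=; congr (_ + _).
rewrite (reindex_omap Some id) /=; first by apply: eq_bigl => v; rewrite eqxx.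
by case.
Qed.

Section StellarComplex.
Variables (V : finType) (K : complex V) (s : {set V}).

(** The vertex [None] is the apex, placed in the interior of [s]. A face without
    the apex is a face of [K] that does not contain [s]; a face with the apex is
    the join of the apex with a face, not containing [s], of the closed star of
    [s]. The definition also makes sense when [s] is not a face: then the apex
    is not a vertex and nothing is changed. *)
Definition stellar_faces :=
  [set T : {set option V} | ~~ (s \subset Some @^-1: T) &
    (if None \in T then s else set0) :|: Some @^-1: T \in K].

Lemma stellar_face_sub (T T' : {set option V}) :
  T' \in stellar_faces -> T \subset T' -> T \in stellar_faces.
Proof.
rewrite !inE => /andP[n k] TT'; have SS := preimsetS Some TT'.
apply/andP; split; first by apply: contra n => /subset_trans; apply.
apply: face_sub k _; apply: setUSS => //.
by case: ifP => [/(subsetP TT')->//|_]; apply: sub0set.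
Qed.

Hypothesis s0 : s != set0.

Lemma stellar_face0 : set0 \in stellar_faces.
Proof. by rewrite !inE preimset0 subset0 s0 setU0 face0. Qed.

Definition stellar : complex (option V) :=
  Complex stellar_face0 stellar_face_sub.

Lemma stellar_apex : s \in K -> [set None] \in stellar.
Proof.
have e : Some @^-1: [set None] = set0 :> {set V}.
  by apply/setP=> v; rewrite !inE.
by move=> sK; rewrite inE e set11 subset0 s0 setU0.
Qed.

End StellarComplex.

Definition stellar_pos (V : finType) (x : point V) (o : option V) : point V :=
  if o is Some v then delta R v else x.

Lemma bary_stellar (V : finType) (x : point V) (t : point (option V)) v :
  barycenter (stellar_pos x) t v = t (Some v) + t None * x v.
Proof.
rewrite baryE big_option addrC; congr (_ + _) => /=.
rewrite -[RHS](sum_delta v (fun u => t (Some u))).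
by apply: eq_bigr => u _; rewrite ffunE mulrC eq_sym.
Qed.

(** The largest multiple of [x] below [y] touches [y] over the support of [x]:
    this is the coordinate of [y] along the apex when a star is seen as a cone
    with apex [x]. *)
Lemma largest_multiple_below (V : finType) (x y : point V) :
    (forall v, 0 <= x v) -> (forall v, 0 <= y v) -> supp x != set0 ->
  exists c v0, [/\ 0 <= c, v0 \in supp x, y v0 = c * x v0
    & forall v, c * x v <= y v].
Proof.
move=> x0 y0 /set0Pn[v1 v1x].
have xp v : v \in supp x -> 0 < x v by rewrite in_supp lt_def x0 andbT.
pose F v := y v / x v.
case: (@arg_minP _ _ _ v1 (mem (supp x)) F v1x) => v0 v0x m.
exists (F v0), v0; split=> //.
- by rewrite divr_ge0.
- by rewrite divfK // gt_eqF ?xp.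
- move=> v; have [vx|/supp0->] := boolP (v \in supp x); last by rewrite mulr0.
  by rewrite -ler_pdivlMr ?xp ?m.
Qed.

(** A point [y] is uniquely [c * x + z], with [z] nonnegative and vanishing
    somewhere on the support of [x]: the coefficient [c] is the one of
    [largest_multiple_below]. *)
Lemma stellar_subd (V : finType) (K : complex V) (x : point V)
    (s0 : supp x != set0) : (forall v, 0 <= x v) -> mass x = 1 ->
  subdivides K (stellar K s0) (stellar_pos x).
Proof.
move=> x0 mx; split.
- by case=> [v|] _ //; apply: mass_delta.
- move=> t /coneP[t0]; rewrite inE => /andP[_ tK]; apply/coneP; split.
    by move=> v; rewrite bary_stellar addr_ge0 ?mulr_ge0.
  apply: face_sub tK _; apply/subsetP=> v; rewrite in_supp bary_stellar.
  apply: contraR; rewrite !inE negb_or negbK => /andP[+ /eqP->].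
  have [->|tN] := eqVneq (t None) 0; first by rewrite mul0r addr0.
  by rewrite add0r inE negbK => /eqP->; rewrite mulr0.
- move=> t t' /coneP[t0 tS] /coneP[t'0 t'S] /ffunP e.
  have le (r r' : point (option V)) : supp r \in stellar K s0 ->
      (forall o, 0 <= r' o) ->
      barycenter (stellar_pos x) r =1 barycenter (stellar_pos x) r' ->
      r' None <= r None.
    rewrite inE => /andP[/subsetPn[v vx + _]] r'0 /(_ v).
    rewrite !bary_stellar !inE negbK => /eqP-> re.
    have xv : 0 < x v by rewrite lt_def x0 -in_supp vx.
    by rewrite -(ler_pM2r xv) -[leRHS]add0r re lerDr.
  have eN : t None = t' None.
    by apply/eqP; rewrite eq_le !le //; move=> v; rewrite e.
  apply/ffunP => -[v|//]; have := e v; rewrite !bary_stellar eN.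
  exact: addIr.
- move=> y /coneP[y0 yK].
  have [c [v0 [c0 v0x yv0 cy]]] := largest_multiple_below x0 y0 s0.
  pose t : point (option V) :=
    [ffun o => if o is Some v then y v - c * x v else c].
  exists t; last first.
    by apply/ffunP=> v; rewrite bary_stellar !ffunE subrK.
  apply/coneP; split; first by case=> [v|]; rewrite ffunE ?subr_ge0.
  rewrite inE; apply/andP; split.
    by apply/subsetPn; exists v0; rewrite // !inE ffunE yv0 subrr eqxx.
  apply: face_sub yK _; apply/subsetP=> v.
  rewrite !inE !ffunE; case/orP.
    case: ifP; rewrite inE // => cN vx; rewrite gt_eqF //.
    by apply: lt_le_trans (cy v); rewrite mulr_gt0 // lt_def ?cN ?vx ?c0 ?x0.
  apply: contra => /eqP yv; rewrite yv sub0r oppr_eq0 eq_le mulr_ge0 // andbT.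
  by have := cy v; rewrite yv.
Qed.

End Stellar.

Section Link.
Variables (V : finType) (K : complex V) (s : {set V}).

Definition link_faces : {set {set V}} :=
  [set t : {set V} | [disjoint s & t] & s :|: t \in K].

Lemma link_face_sub (t t' : {set V}) :
  t' \in link_faces -> t \subset t' -> t \in link_faces.
Proof.
rewrite !inE => /andP[d k] tt'; apply/andP; split.
  exact: disjointWr tt' d.
exact/(face_sub k)/setUS.
Qed.

Hypothesis sK : s \in K.

Lemma link_face0 : set0 \in link_faces.
Proof. by rewrite inE setU0 sK -setI_eq0 setI0 eqxx. Qed.

Definition link : complex V := Complex link_face0 link_face_sub.

End Link.

Section VertexLink.
Variable R : realType.
Local Notation point V := {ffun V -> R}.

Lemma mass1_lt1 (V : finType) (t : point V) v :
  (forall u, 0 <= t u) -> mass t = 1 -> t != delta R v -> t v < 1.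
Proof.
move=> t0 m; apply: contraR; rewrite -leNgt => tv; apply/eqP.
apply: delta_of_supp => //; apply/subsetP=> u; rewrite in_supp inE.
apply: contraR => uv; move: m; rewrite /mass (bigD1 v) // (bigD1 u) //= => m.
have r0 : 0 <= \sum_(i | (i != v) && (i != u)) t i by apply: sumr_ge0.
have := t0 u; rewrite eq_le => ->; rewrite andbT.
by lra.
Qed.

Variables (V U : finType) (K : complex V) (P : complex U) (p : U -> point V).
Variables (v : V) (w : U) (vK : [set v] \in K) (wP : [set w] \in P).
Hypotheses (KP : subdivides K P p) (pw : p w = delta R v).

Let k u : R := 1 - p u v.

Let k_gt0 u : [set u] \in P -> u != w -> 0 < k u.
Proof.
move=> uP uw; rewrite subr_gt0 mass1_lt1 ?(subd_mass1 KP) //.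
  by move=> v'; apply: (subd_ge0 KP).
by apply: contra uw; rewrite -pw => /eqP/(subd_vertex_inj KP uP wP)->.
Qed.

Let kw : k w = 0.
Proof. by rewrite /k pw ffunE eqxx subrr. Qed.

(** The projection of [p u] from the vertex [v] onto its link: [p u] is
    [k u] times this point plus [1 - k u] times [v]. *)
Definition link_proj u : point V :=
  [ffun v' => if v' == v then 0 else p u v' / k u].

Let mem_link (t : point U) : t \in cone (link wP) ->
  [/\ forall u, 0 <= t u, w |: supp t \in P, t w = 0
    & forall u, u \in supp t -> [set u] \in P /\ u != w].
Proof.
case/coneP=> t0; rewrite inE => /andP[d tP].
have wt : w \notin supp t by rewrite disjoints1 in d.
split=> //; first exact: supp0.
move=> u ut; split; first by apply: supp_vertex tP _; rewrite inE ut orbT.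
by apply: contraNneq wt => <-.
Qed.

Let proj_ge0 u v' : [set u] \in P -> u != w -> 0 <= link_proj u v'.
Proof.
move=> uP uw; rewrite ffunE; case: ifP => // _.
by rewrite divr_ge0 ?(subd_ge0 KP) // ltW ?k_gt0.
Qed.

(* With these weights on the vertices of [P], the image under [p] is the
   projection of [t] plus a multiple of [v], which the weight [b] of [w] can
   adjust. *)
Let lift b (t : point U) : point U :=
  [ffun u => if u == w then b else t u / k u].

Let lift_cone b (t : point U) :
  0 <= b -> t \in cone (link wP) -> lift b t \in cone P.
Proof.
move=> b0 /mem_link[t0 tP tw tv]; apply/coneP; split.
  move=> u; rewrite ffunE; case: eqP => // /eqP uw.
  have [/tv[uP _]|/supp0->] := boolP (u \in supp t); last by rewrite mul0r.
  by rewrite divr_ge0 // ltW ?k_gt0.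
apply: face_sub tP _; apply/subsetP=> u; rewrite !inE ffunE.
have [//|uw] := eqVneq u w.
by apply: contra => /eqP->; rewrite mul0r.
Qed.

Let bary_lift b (t : point U) : t \in cone (link wP) ->
  barycenter p (lift b t) = barycenter link_proj t +
    scale (b + \sum_u t u / k u - mass t) (delta R v).
Proof.
move=> /mem_link[t0 tP tw tv]; apply/ffunP=> v'; rewrite !ffunE.
have lw u : lift b t u = t u / k u + b * (u == w)%:R.
  by rewrite ffunE; case: eqP => [->|_];
    rewrite ?tw ?mul0r ?mulr0 ?add0r ?mulr1 ?addr0.
under eq_bigr => u _ do rewrite lw mulrDl.
rewrite big_split /=.
have -> : \sum_u b * (u == w)%:R * p u v' = b * (v' == v)%:R.
  under eq_bigr => u _ do rewrite -mulrA.
  by rewrite -mulr_sumr sum_delta pw ffunE.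
have [->|v'v] := eqVneq v' v; last first.
  rewrite !mulr0 !addr0; apply: eq_bigr => u _.
  by rewrite ffunE (negPf v'v) mulrAC mulrA.
have -> : \sum_u t u * link_proj u v = 0.
  by apply: big1 => u _; rewrite ffunE eqxx mulr0.
rewrite !mulr1 add0r addrC -addrA; congr (_ + _).
rewrite /mass -sumrB; apply: eq_bigr => u _.
have [/tv[uP uw]|/supp0->] := boolP (u \in supp t);
  last by rewrite !mul0r subrr.
have k0 : k u != 0 by rewrite gt_eqF ?k_gt0.
rewrite (_ : p u v = 1 - k u); last by rewrite /k; ring.
by field.
Qed.

(** Injectivity: two points of the link with the same projection become the
    same point of [K] after adding suitable multiples of [v], hence have the
    same coordinates in [P]. Surjectivity: for [y] in the link of [v], the
    vector [y + b * v] with [b] large is so close to the direction of [v] that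
    only simplices of [P] that contain [w] can reach it. *)
Lemma subd_link_vertex : subdivides (link vK) (link wP) link_proj.
Proof.
have m1 u : [set u] \in P -> u != w -> mass (link_proj u) = 1.
  move=> uP uw; have k0 : k u != 0 by rewrite gt_eqF ?k_gt0.
  have e : \sum_(v' | v' != v) p u v' = k u.
    rewrite /k -(subd_mass1 KP uP) /mass [in RHS](bigD1 v) //=.
    by rewrite addrAC subrr add0r.
  rewrite /mass (bigD1 v) //= ffunE eqxx add0r -[RHS](divff k0) -{1}e mulr_suml.
  apply: eq_bigr => v' v'v.
  by rewrite ffunE (negPf v'v).
have mC t : t \in cone (link wP) -> mass (barycenter link_proj t) = mass t.
  by case/mem_link=> _ _ _ tv; apply: mass_bary => u /tv[]; apply: m1.
split.
- move=> u; rewrite inE => /andP[d uP].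
  apply: m1; first by apply: supp_vertex uP _; rewrite !inE eqxx orbT.
  by rewrite disjoints1 inE eq_sym in d.
- move=> t /mem_link[t0 tP tw tv].
  have pge u : u \in supp t -> forall v', 0 <= link_proj u v'.
    by move=> /tv[uP uw] v'; apply: proj_ge0.
  apply/coneP; split; first exact: bary_ge0.
  rewrite inE supp_bary //; apply/andP; split.
    rewrite disjoints1; apply/bigcupP=> -[u _].
    by rewrite in_supp ffunE eqxx eqxx.
  apply: face_sub (subd_face KP tP) _; apply/subsetP=> v'.
  case/setU1P=> [->|/bigcupP[u ut]].
    by apply/bigcupP; exists w; rewrite ?setU11 // pw supp_delta set11.
  rewrite in_supp ffunE; case: ifP; rewrite ?eqxx // => _ h.
  apply/bigcupP; exists u; first by rewrite inE ut orbT.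
  by rewrite in_supp; apply: contra h => /eqP->; rewrite mul0r.
- move=> t t' tL t'L e.
  pose a := \sum_u t u / k u; pose a' := \sum_u t' u / k u.
  have sum_ge0 r : r \in cone (link wP) -> 0 <= \sum_u r u / k u.
    case/mem_link=> r0 _ _ rv; apply: sumr_ge0 => u _.
    have [/rv[uP uw]|/supp0->] := boolP (u \in supp r); last by rewrite mul0r.
    by rewrite divr_ge0 // ltW ?k_gt0.
  (* The crossed weights make the total coefficients of [v] equal. *)
  have : lift a' t = lift a t'.
    apply: (subd_inj KP); rewrite ?lift_cone ?sum_ge0 // !bary_lift //.
    by rewrite -(mC t) // -(mC t') // e -/a -/a' (addrC a').
  move/ffunP=> el; apply/ffunP=> u; have := el u; rewrite !ffunE.
  have [_ _ tw tv] := mem_link tL; have [_ _ t'w t'v] := mem_link t'L.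
  case: eqP => [-> _|/eqP uw]; first by rewrite tw t'w.
  have [uP|uNP] := boolP ([set u] \in P).
    by apply: mulIf; rewrite invr_eq0 gt_eqF ?k_gt0.
  have z r : (forall u, u \in supp r -> [set u] \in P /\ u != w) -> r u = 0.
    by move=> h; apply: supp0; apply: contra uNP => /h[].
  by rewrite !z.
- move=> y /coneP[y0]; rewrite inE => /andP[+ yK].
  rewrite disjoints1 => /supp0 yv.
  pose Q u := ([set u] \in P) && (u != w).
  pose M := \big[Num.max/0]_(u | Q u) p u v.
  have M1 : M < 1.
    by apply: bigmax_lt => // u /andP[uP uw]; rewrite -subr_gt0 k_gt0.
  have M0 : 0 <= M by apply: bigmax_ge_id.
  have my : 0 <= mass y by apply: sumr_ge0.
  (* A vertex other than [w] has coordinate at most [M] along [v], and [b] is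
     chosen so that [y + b * v] exceeds this ratio. *)
  pose b := (M * mass y + 1) / (1 - M).
  have b0 : 0 < b by rewrite divr_gt0 ?subr_gt0 // ltr_wpDl ?mulr_ge0.
  pose z := y + scale b (delta R v).
  have zE v' : z v' = y v' + b * (v' == v)%:R by rewrite !ffunE.
  have zK : z \in cone K.
    apply/coneP; split.
      by move=> v'; rewrite zE addr_ge0 // mulr_ge0 ?ler0n // ltW.
    apply: face_sub yK _; apply/subsetP=> v'; rewrite in_supp zE !inE.
    by have [//|v'v] := eqVneq v' v; rewrite mulr0 addr0.
  have mz : mass z = mass y + b.
    rewrite /mass; under eq_bigr => v' _ do rewrite zE mulrC.
    by rewrite big_split /= sum_delta.
  have [T TP Tz] := subd_surj KP zK.
  have [T0 sT] := coneP _ _ TP.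
  have mT : mass T = mass y + b by rewrite -mz -Tz (subd_mass KP).
  have Tw : w \in supp T.
    apply: contraT => /supp0 Tw0; have : b <= M * (mass y + b).
      have bz : b = z v by rewrite zE yv eqxx add0r mulr1.
      rewrite -mT [leLHS]bz -Tz baryE /mass mulr_sumr; apply: ler_sum => u _.
      have [uT|/supp0->] := boolP (u \in supp T); last by rewrite mul0r mulr0.
      rewrite mulrC ler_wpM2r //.
      apply: (le_bigmax_cond _ (fun u => p u v)).
      rewrite /Q (supp_vertex sT uT) /=.
      by apply: contraTneq uT => ->; rewrite in_supp Tw0 eqxx.
    have bE : b * (1 - M) = M * mass y + 1 by rewrite divfK // gt_eqF ?subr_gt0.
    by move=> h; exfalso; lra.
  pose t : point U := [ffun u => T u * k u].
  have tw : t w = 0 by rewrite ffunE kw mulr0.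
  exists t; last first.
    apply/ffunP=> v'; rewrite baryE; have [->|v'v] := eqVneq v' v.
      by rewrite yv big1 // => u _; rewrite [link_proj u v]ffunE eqxx mulr0.
    have -> : y v' = z v' by rewrite zE (negPf v'v) mulr0 addr0.
    rewrite -Tz baryE; apply: eq_bigr => u _.
    rewrite !ffunE (negPf v'v); have [->|uw] := eqVneq u w.
      by rewrite kw pw ffunE (negPf v'v) !(mulr0, mul0r).
    have [uT|/supp0->] := boolP (u \in supp T); last by rewrite !mul0r.
    have k0 : k u != 0 by rewrite gt_eqF ?k_gt0 ?(supp_vertex sT).
    by field.
  apply/coneP; split.
    move=> u; rewrite ffunE; have [->|uw] := eqVneq u w.
      by rewrite kw mulr0.
    have [uT|/supp0->] := boolP (u \in supp T); last by rewrite mul0r.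
    by rewrite mulr_ge0 // ltW ?k_gt0 ?(supp_vertex sT).
  rewrite inE disjoints1 in_supp tw eqxx /=; apply: face_sub sT _.
  apply/subsetP=> u /setU1P[->//|]; rewrite !inE ffunE.
  by apply: contra => /eqP->; rewrite mul0r.
Qed.

End VertexLink.

(** * Refinement by linear functions *)

Section Cut.
Variable R : realType.
Local Notation point V := {ffun V -> R}.

Definition lform (V : finType) (h y : point V) : R := \sum_v h v * y v.

Lemma lform_bary (U V : finType) (h : point V) (p : U -> point V) t :
  lform h (barycenter p t) = lform [ffun u => lform h (p u)] t.
Proof.
rewrite /lform; under eq_bigr => v _ do rewrite baryE mulr_sumr.
rewrite exchange_big; apply: eq_bigr => u _ /=; rewrite ffunE mulr_suml.
by apply: eq_bigr => v _; rewrite mulrCA mulrC.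
Qed.

Lemma lform_delta (V : finType) (h : point V) v : lform h (delta R v) = h v.
Proof.
rewrite -[RHS](sum_delta v h); apply: eq_bigr => u _.
by rewrite ffunE mulrC.
Qed.

Definition one_sided (U : finType) (P : complex U) (h : point U) : Prop :=
  forall s, s \in P ->
    (forall u, u \in s -> 0 <= h u) \/ (forall u, u \in s -> h u <= 0).

Lemma one_sided_subd (U W : finType) (P : complex U) (Q : complex W) r h :
  subdivides P Q r -> one_sided P h ->
  one_sided Q [ffun w => lform h (r w)].
Proof.
move=> PQ hP s sQ; have sup w u : w \in s -> u \in supp (r w) ->
    u \in \bigcup_(w in s) supp (r w).
  by move=> ws uw; apply/bigcupP; exists w.
have r0 w u : w \in s -> 0 <= r w u.
  by move=> ws; apply: (subd_ge0 PQ); apply: supp_vertex sQ ws.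
case: (hP _ (subd_face PQ sQ)) => h0; [left|right] => w ws; rewrite ffunE.
  apply: sumr_ge0 => u _.
  have [/(sup _ _ ws)/h0 uw|/supp0->] := boolP (u \in supp (r w)).
    by rewrite mulr_ge0 ?r0.
  by rewrite mulr0.
apply: sumr_le0 => u _.
have [/(sup _ _ ws)/h0 uw|/supp0->] := boolP (u \in supp (r w)).
  by rewrite mulr_le0_ge0 ?r0.
by rewrite mulr0.
Qed.

Definition crossing (U : finType) (P : complex U) (h : point U) :=
  [set e : U * U | [&& h e.1 < 0, 0 < h e.2 & [set e.1; e.2] \in P]].

(** Star the edge at the zero of [h]. New edges end at this zero, so they do not
    cross, and the starred edge is gone. *)
Lemma star_crossing_edge (U : finType) (P : complex U) (h : point U) e :
    e \in crossing P h ->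
  exists (P' : complex (option U)) (r : option U -> point U),
    subdivides P P' r /\
    (#|crossing P' [ffun o => lform h (r o)]| < #|crossing P h|)%N.
Proof.
case: e => a b eP; have := eP; rewrite inE /= => /and3P[ha hb abP].
pose x : point U := [ffun u => (h b / (h b - h a)) * (u == a)%:R +
  (- h a / (h b - h a)) * (u == b)%:R].
have d0 : 0 < h b - h a by lra.
have ab : a != b by apply/eqP => e; move: ha hb; rewrite e; lra.
have la : 0 < h b / (h b - h a) by rewrite divr_gt0.
have lb : 0 < - h a / (h b - h a) by rewrite divr_gt0 ?oppr_gt0.
have xa : x a = h b / (h b - h a).
  by rewrite ffunE eqxx (negPf ab) mulr0 addr0 mulr1.
have xb : x b = - h a / (h b - h a).
  by rewrite ffunE eqxx eq_sym (negPf ab) mulr0 add0r mulr1.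
have x0 u : 0 <= x u by rewrite ffunE addr_ge0 // mulr_ge0 ?ler0n // ltW.
have sum_x (F : U -> R) : \sum_u F u * x u =
    h b / (h b - h a) * F a + - h a / (h b - h a) * F b.
  rewrite -(sum_delta a F) -(sum_delta b F) !mulr_sumr -big_split.
  by apply: eq_bigr => u _ /=; rewrite ffunE; ring.
have mx : mass x = 1.
  transitivity (\sum_u 1 * x u); first by apply: eq_bigr => u _; rewrite mul1r.
  by rewrite sum_x; field; rewrite gt_eqF.
have hx : lform h x = 0 by rewrite /lform sum_x; field; rewrite gt_eqF.
have ax : a \in supp x by rewrite in_supp xa gt_eqF.
have bx : b \in supp x by rewrite in_supp xb gt_eqF.
have s0 : supp x != set0 by apply/set0Pn; exists a.
exists (stellar P s0), (stellar_pos x); split; first exact: stellar_subd.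
pose f (e : U * U) := (Some e.1, Some e.2).
have sub : crossing (stellar P s0) [ffun o => lform h (stellar_pos x o)] \subset
    [set f e | e in crossing P h :\ (a, b)].
  apply/subsetP=> -[[u|] [u'|]]; rewrite inE !ffunE /= ?hx ?ltxx ?andbF //.
  rewrite !lform_delta => /and3P[hu hu']; rewrite inE.
  have -> : Some @^-1: [set Some u; Some u'] = [set u; u'] :> {set U}.
    by apply/setP=> z; rewrite !inE.
  rewrite !inE /= set0U => /andP[nsub uuP]; apply/imsetP; exists (u, u') => //.
  rewrite !inE /= hu hu' uuP !andbT; apply: contra nsub => /eqP[-> ->].
  apply/subsetP=> z; rewrite in_supp ffunE !inE; apply: contraR.
  by rewrite negb_or => /andP[/negPf-> /negPf->]; rewrite !mulr0 addr0 eqxx.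
apply: leq_ltn_trans (subset_leq_card sub) _.
apply: leq_ltn_trans (leq_imset_card _ _) _.
by rewrite [ltnRHS](cardsD1 (a, b)) eP.
Qed.

(** Induction on the number of crossing edges; a simplex without crossing edges
    is on one side. *)
Lemma one_sided_refinement (U : finType) (P : complex U) (h : point U) :
  exists (W : finType) (P' : complex W) (r : W -> point U),
    subdivides P P' r /\ one_sided P' [ffun w => lform h (r w)].
Proof.
have [n] := ubnP #|crossing P h|; elim: n U P h => // n IH U P h.
have [c0 _|[e /[dup] eP /star_crossing_edge[P1 [r1 [PP1 lt1]]]]] :=
  set_0Vmem (crossing P h).
  exists U, P, (@delta R U); split; first exact: subd_refl.
  move=> s sP; have [/existsP[u /andP[us hu]]|/existsPn hn] :=
    boolP [exists u, (u \in s) && (h u < 0)]; [right|left] => u' u's;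
    rewrite ffunE lform_delta.
    rewrite leNgt; apply/negP => hu'.
    suff : (u, u') \in crossing P h by rewrite c0 inE.
    rewrite inE /= hu hu'; apply: face_sub sP _.
    by apply/subsetP=> z; rewrite !inE => /orP[]/eqP->.
  by have := hn u'; rewrite u's /= -leNgt.
rewrite ltnS => /(leq_trans lt1)/IH[W [P' [r [P1P' os]]]].
exists W, P', (fun w => barycenter r1 (r w)); split;
  first exact: subd_trans PP1 P1P'.
move=> s /os; case=> hs; [left|right] => w /hs; rewrite !ffunE lform_bary //.
Qed.

Lemma one_sided_refinement_seq (V U : finType) (p : U -> point V)
    (P : complex U) (hs : seq (point V)) :
  exists (W : finType) (P' : complex W) (r : W -> point U),
    subdivides P P' r /\ forall h, h \in hs ->
      one_sided P' [ffun w => lform h (barycenter p (r w))].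
Proof.
elim: hs U p P => [|h hs IH] U p P.
  by exists U, P, (@delta R U); split; first exact: subd_refl.
have [W1 [P1 [r1 [PP1 os1]]]] :=
  one_sided_refinement P [ffun u => lform h (p u)].
have [W [P' [r [P1P' os]]]] := IH _ (fun w => barycenter p (r1 w)) P1.
exists W, P', (fun w => barycenter r1 (r w)); split;
  first exact: subd_trans PP1 P1P'.
move=> h'; rewrite inE => /orP[/eqP->|/os os'].
  have e w : lform h (barycenter p (barycenter r1 (r w))) =
      lform [ffun w1 => lform [ffun u => lform h (p u)] (r1 w1)] (r w).
    by rewrite !lform_bary.
  move=> s /(one_sided_subd P1P' os1)[] hs'; [left|right] => w /hs';
    by rewrite !ffunE e.
by move=> s /os'[] hs'; [left|right] => w /hs'; rewrite !ffunE bary_bary.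
Qed.

End Cut.

Section Refine.
Variable R : realType.
Local Notation point V := {ffun V -> R}.

(** The positions in [Q] of the vertices of [P] are determined by [g]; the
    condition on faces says that their linear extension stays in the cone over
    [Q], so that it is the lift of the linear extension of [g]. *)
Lemma subd_lift (V W U : finType) (K : complex V) (Q : complex W)
    (P : complex U) (q : W -> point V) (g : U -> point V) :
  subdivides K Q q -> subdivides K P g ->
  (forall s, s \in P -> exists2 F, F \in Q & forall u t, u \in s ->
     t \in cone Q -> barycenter q t = g u -> supp t \subset F) ->
  exists p : U -> point W, subdivides Q P p /\
    forall u, [set u] \in P -> p u \in cone Q /\ barycenter q (p u) = g u.
Proof.
move=> KQ KP HF.
have /boolp.choice[p Hp] : forall u, exists t : point W,
    [set u] \in P -> t \in cone Q /\ barycenter q t = g u.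
  move=> u; have [/(subd_vertex KP)|_] := boolP ([set u] \in P).
    by case/(subd_surj KQ) => t tQ e; exists t.
  by exists 0.
exists p; split => //.
have gE t : t \in cone P -> barycenter q (barycenter p t) = barycenter g t.
  case/coneP=> _ sP; rewrite bary_bary; apply: eq_bary => u ut.
  by case: (Hp _ (supp_vertex sP ut)).
have cP t : t \in cone P -> barycenter p t \in cone Q.
  case/coneP=> t0 sP; have [F FQ Fs] := HF _ sP.
  have pge u : u \in supp t -> forall v, 0 <= p u v.
    by move=> /(supp_vertex sP)/Hp[/cone_ge0 + _] v; apply.
  apply/coneP; split; first exact: bary_ge0.
  apply: face_sub FQ _; rewrite supp_bary //; apply/bigcupsP => u ut.
  by have [] := Hp _ (supp_vertex sP ut); apply: Fs.
split=> //.
- move=> u uP; have [pQ e] := Hp _ uP.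
  by rewrite -(subd_mass KQ pQ) e (subd_mass1 KP).
- move=> t t' tP t'P e; apply: (subd_inj KP) => //.
  by rewrite -!gE // e.
- move=> z zQ; have [t tP e] := subd_surj KP (subd_cone KQ zQ).
  exists t => //; apply: (subd_inj KQ); rewrite ?cP //.
  by rewrite gE.
Qed.

(** The simplex of the stellar subdivision that contains a point [y] depends on
    where on the support of [x] the ratio [y v / x v] is minimal. When the
    differences of these ratios keep their signs on each simplex [s] of [P], one
    place [v0] is minimal for all vertices of [s], and the whole image of [s]
    avoids [v0] after subtraction of multiples of [x]. *)
Lemma stellar_lift (V U : finType) (K : complex V) (P : complex U)
    (g : U -> point V) (x : point V) (s0 : supp x != set0) :
  subdivides K P g -> (forall v, 0 <= x v) -> mass x = 1 ->
  (forall v v', v \in supp x -> v' \in supp x ->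
     one_sided P [ffun u => g u v * x v' - g u v' * x v]) ->
  exists p : U -> point (option V), subdivides (stellar K s0) P p /\
    forall u, [set u] \in P -> p u \in cone (stellar K s0) /\
      barycenter (stellar_pos x) (p u) = g u.
Proof.
move=> KP x0 mx os; apply: (subd_lift (stellar_subd K s0 x0 mx) KP).
move=> s sP; pose S := \bigcup_(u in s) supp (g u).
have SK : S \in K := subd_face KP sP.
have g0 u v : u \in s -> 0 <= g u v.
  by move=> us; apply/(subd_ge0 KP)/(supp_vertex sP us).
have xp v : v \in supp x -> 0 < x v by rewrite in_supp lt_def x0 andbT.
have [v0 v0x v0m] : exists2 v0, v0 \in supp x & forall u v, u \in s ->
    v \in supp x -> g u v0 * x v <= g u v * x v0.
  (* A place that is minimal for the sum over [s] is minimal for each summand,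
     since the differences have one sign. *)
  pose Y : point V := [ffun v => \sum_(u in s) g u v].
  have Y0 v : 0 <= Y v by rewrite ffunE; apply: sumr_ge0 => u /g0.
  have [c [v0 [c0 v0x Yv0 cY]]] := largest_multiple_below x0 Y0 s0.
  exists v0 => // u v us vx.
  have le0 : \sum_(u in s) (g u v0 * x v - g u v * x v0) <= 0.
    rewrite sumrB -!mulr_suml subr_le0.
    have := Yv0; have := cY v; rewrite !ffunE => cv ->.
    by rewrite mulrAC ler_wpM2r ?(ltW (xp _ v0x)).
  have [h|h] := os _ _ v0x vx _ sP; last first.
    by have := h _ us; rewrite ffunE subr_le0.
  have h' u' : u' \in s -> 0 <= g u' v0 * x v - g u' v * x v0.
    by move=> /h; rewrite ffunE.
  have /psumr_eq0P e : \sum_(u in s) (g u v0 * x v - g u v * x v0) = 0.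
    by apply/eqP; rewrite eq_le le0 sumr_ge0.
  by have /eqP := e h' _ us; rewrite subr_eq0 => /eqP->.
pose F := [set o : option V | if o is Some v then (v != v0) && (v \in S)
  else supp x \subset S].
exists F.
  rewrite inE; apply/andP; split.
    by apply/subsetPn; exists v0 => //; rewrite !inE eqxx.
  apply: face_sub SK _; apply/subsetP=> v; rewrite inE => /orP[|].
    case: ifP => [|_]; last by rewrite inE.
    by rewrite inE => /subsetP xS vx; apply: xS.
  by rewrite !inE => /andP[_ ->].
move=> u t us /coneP[t0]; rewrite inE => /andP[/subsetPn[v1 v1x] + _] e.
rewrite !inE negbK => /eqP t1.
have gE v : g u v = t (Some v) + t None * x v by rewrite -e bary_stellar.
have gS v : 0 < g u v -> v \in S.
  by move=> gv; apply/bigcupP; exists u; rewrite ?in_supp ?gt_eqF.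
apply/subsetP=> -[v|]; rewrite in_supp => tv; have tp := t0 _; rewrite inE.
  apply/andP; split; last first.
    apply: gS; rewrite gE ltr_wpDr ?mulr_ge0 //.
    by rewrite lt_def tv t0.
  apply: contra tv => /eqP->; rewrite eq_le t0 andbT.
  have := v0m _ _ us v1x; rewrite !gE t1 add0r mulrDl mulrAC gerDr.
  by rewrite pmulr_lle0 ?xp.
apply/subsetP=> v vx; apply: gS; rewrite gE ltr_wpDl // mulr_gt0 ?xp //.
by rewrite lt_def tv t0.
Qed.

(** Any vertex [w] of a subdivision of [K] can be made the apex: refine until
    the functions in [stellar_lift] are one-sided. *)
Lemma subd_stellar_vertex (V U : finType) (K : complex V) (P : complex U)
    (p : U -> point V) w :
  subdivides K P p -> [set w] \in P -> forall s0 : supp (p w) != set0,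
  exists (W : finType) (P' : complex W) (r : W -> point U)
    (q : W -> point (option V)) (w' : W),
    [/\ subdivides P P' r, subdivides (stellar K s0) P' q, [set w'] \in P',
      r w' = delta R w & q w' = delta R None].
Proof.
move=> KP wP s0; set x := p w in s0 *.
have [x0 xK] := coneP _ _ (subd_vertex KP wP); have mx := subd_mass1 KP wP.
pose h v v' : point V := [ffun z => x v' * (z == v)%:R - x v * (z == v')%:R].
have hE v v' y : lform (h v v') y = y v * x v' - y v' * x v.
  rewrite -(sum_delta v y) -(sum_delta v' y) !mulr_suml -sumrB.
  by apply: eq_bigr => z _; rewrite ffunE; ring.
pose hs := [seq h e.1 e.2 | e <- enum [set: V * V]].
have [W [P' [r [PP' os]]]] := one_sided_refinement_seq p P hs.
have KP' := subd_trans KP PP'.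
have [|q [SP' Hq]] := stellar_lift s0 KP' x0 mx.
  move=> v v' _ _ s sP; have hin : h v v' \in hs.
    by apply/mapP; exists (v, v'); rewrite // mem_enum inE.
  by case: (os _ hin s sP) => hs'; [left|right] => u /hs';
    rewrite ffunE hE => le_h; rewrite ffunE.
have [w' w'P rw'] := subd_over_vertex PP' wP.
exists W, P', r, q, w'; split=> //.
have [qS e] := Hq _ w'P.
apply: (subd_inj (stellar_subd K s0 x0 mx)) => //.
  exact/cone_delta/stellar_apex.
by rewrite e rw' !bary_delta.
Qed.

End Refine.

(** * Isomorphic complexes, and links in PL spheres *)

Section Relabel.
Variable R : realType.
Local Notation point V := {ffun V -> R}.

(** Two mutually inverse simplicial maps, given on vertices only. *)
Lemma subd_inverse (V U : finType) (K : complex V) (P : complex U)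
    (p : U -> point V) (q : V -> point U) :
  (forall u, [set u] \in P -> mass (p u) = 1) ->
  (forall t, t \in cone P -> barycenter p t \in cone K) ->
  (forall y, y \in cone K -> barycenter q y \in cone P) ->
  (forall u, [set u] \in P -> barycenter q (p u) = delta R u) ->
  (forall v, [set v] \in K -> barycenter p (q v) = delta R v) ->
  subdivides K P p.
Proof.
have id (X Y : finType) (L : complex X) (a : X -> point Y)
    (b : Y -> point X) t :
    (forall u, [set u] \in L -> barycenter b (a u) = delta R u) ->
    t \in cone L -> barycenter b (barycenter a t) = t.
  move=> h /coneP[_ tL]; rewrite bary_bary -[RHS]bary_id.
  apply: eq_bary => u ut.
  exact/h/(supp_vertex tL).
move=> m c c' e e'; split=> // [t t' tP t'P et|y yK].
  by rewrite -(id _ _ _ _ _ _ e tP) et (id _ _ _ _ _ _ e).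
by exists (barycenter q y); rewrite ?c' // (id _ _ _ _ _ _ e').
Qed.

(** An isomorphism between the posets of non-empty faces matches the minimal
    elements, that is the vertices, and hence comes from a simplicial
    isomorphism, of which each side is a subdivision. It is given by a relation
    [rel], not by a map from [W] to [V]: if all the elements of [W] fail to be
    vertices, then [V] may be empty. *)
Lemma subd_poset_iso (V W : finType) (A : complex W) (B : complex V)
    (Phi : {set W} -> {set V}) :
  (forall s, s \in A -> s != set0 -> Phi s \in B /\ Phi s != set0) ->
  (forall s t, s \in A -> s != set0 -> t \in A -> t != set0 ->
     (Phi s \subset Phi t) = (s \subset t)) ->
  (forall t, t \in B -> t != set0 ->
     exists s, [/\ s \in A, s != set0 & Phi s = t]) ->
  exists p : W -> point V, subdivides B A p.
Proof.
move=> PhiB mono surj.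
have set1_neq0 (X : finType) (x : X) : [set x] != set0.
  by apply/set0Pn; exists x; rewrite inE.
pose rel w v := ([set w] \in A) && (Phi [set w] == [set v]).
have inj w w' : [set w] \in A -> [set w'] \in A ->
    Phi [set w] = Phi [set w'] -> w = w'.
  move=> wA w'A e; apply/eqP; rewrite -in_set1 -sub1set -mono ?set1_neq0 //.
  by rewrite e.
have relA w : [set w] \in A -> exists2 v, rel w v & [set v] \in B.
  move=> wA; have [PB /set0Pn[v vP]] := PhiB _ wA (set1_neq0 _ w).
  have vB := supp_vertex PB vP; exists v => //; rewrite /rel wA /=.
  have [s [sA s0 e]] := surj _ vB (set1_neq0 _ v).
  have : s \subset [set w] by rewrite -mono ?set1_neq0 // e sub1set.
  by rewrite subset1 (negPf s0) orbF => /eqP <-; rewrite e.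
have relB v : [set v] \in B -> exists w, rel w v.
  move=> vB; have [s [sA s0 e]] := surj _ vB (set1_neq0 _ v).
  have /set0Pn[w ws] := s0; exists w; have wA := supp_vertex sA ws.
  have [v' /[dup] r /andP[_ /eqP e'] _] := relA _ wA.
  have : Phi [set w] \subset Phi s by rewrite mono ?sub1set ?set1_neq0.
  by rewrite e e' sub1set in_set1 => /eqP <-.
have rel_fun w v v' : rel w v -> rel w v' -> v = v'.
  by move=> /andP[_ /eqP e] /andP[_ /eqP]; rewrite e => /set1_inj.
have rel_inj w w' v : rel w v -> rel w' v -> w = w'.
  by move=> /andP[wA /eqP e] /andP[w'A /eqP e']; apply: inj; rewrite // e e'.
pose p w : point V := [ffun v => (rel w v)%:R].
pose q v : point W := [ffun w => (rel w v)%:R].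
have pE w v : rel w v -> p w = delta R v.
  move=> r; apply/ffunP=> v'; rewrite !ffunE; congr (nat_of_bool _)%:R.
  by apply/idP/eqP => [/rel_fun/(_ r)|->].
have qE w v : rel w v -> q v = delta R w.
  move=> r; apply/ffunP=> w'; rewrite !ffunE; congr (nat_of_bool _)%:R.
  by apply/idP/eqP => [/rel_inj/(_ r)|->].
exists p; apply: (subd_inverse (q := q)).
- by move=> w /relA[v /pE-> _]; apply: mass_delta.
- move=> t /coneP[t0 tA]; apply/coneP.
  have p0 w v : 0 <= p w v by rewrite ffunE ler0n.
  split; first exact: bary_ge0.
  rewrite supp_bary //; have [->|s0] := eqVneq (supp t) set0.
    by rewrite big_set0 face0.
  apply: face_sub (proj1 (PhiB _ tA s0)) _; apply/bigcupsP => w wt.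
  apply/subsetP=> v; rewrite in_supp ffunE pnatr_eq0 eqb0 negbK.
  move=> /andP[wA /eqP e].
  by rewrite -sub1set -e mono ?set1_neq0 // sub1set.
- move=> y /coneP[y0 yB]; apply/coneP.
  have q0 v w : 0 <= q v w by rewrite ffunE ler0n.
  split; first exact: bary_ge0.
  rewrite supp_bary //; have [->|s0] := eqVneq (supp y) set0.
    by rewrite big_set0 face0.
  have [s [sA sN0 e]] := surj _ yB s0.
  apply: (face_sub sA); apply/bigcupsP => v vy.
  apply/subsetP=> w; rewrite in_supp ffunE pnatr_eq0 eqb0 negbK.
  move=> /andP[wA /eqP e'].
  by rewrite -sub1set -mono ?set1_neq0 // e e' sub1set.
- by move=> w /relA[v r _]; rewrite (pE _ _ r) bary_delta (qE _ _ r).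
- by move=> v /relB[w r]; rewrite (qE _ _ r) bary_delta (pE _ _ r).
Qed.

(** Taking [psi] from the vertices of the subdivided complex leaves the elements
    of [W] that are not vertices of [A] free. *)
Lemma subd_relabel (V W : finType) (A : complex W) (B : complex V)
    (psi : V -> W) : injective psi ->
  (forall t : {set V}, (psi @: t \in A) = (t \in B)) ->
  (forall w, [set w] \in A -> exists v, w = psi v) ->
  exists p : W -> point V, subdivides B A p.
Proof.
move=> inj AB cod.
have preK s : s \in A -> psi @: (psi @^-1: s) = s.
  move=> sA; apply/setP=> w; apply/imsetP/idP => [[v + ->]|ws].
    by rewrite inE.
  by have [v e] := cod _ (supp_vertex sA ws); exists v; rewrite // inE -e.
have Kpre (t : {set V}) : psi @^-1: (psi @: t) = t.
  by apply/setP=> v; rewrite inE mem_imset.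
apply: (subd_poset_iso (Phi := fun s => psi @^-1: s)).
- move=> s sA s0; rewrite -AB preK //; split=> //.
  by apply: contra s0 => /eqP e; rewrite -(preK _ sA) e imset0.
- move=> s t sA _ tA _; apply/idP/idP => [/(imsetS psi)|/preimsetS->//].
  by rewrite !preK.
- move=> t tB t0; exists (psi @: t); rewrite AB Kpre; split=> //.
  by rewrite imset_eq0.
Qed.

End Relabel.

Section TwoPart.
Variables (V : finType) (A : {set V}).

(** The join of the boundaries of the simplices on [A] and on its complement. *)
Definition two_part_faces : {set {set V}} :=
  [set t : {set V} | ~~ (A \subset t) & ~~ (~: A \subset t)].

Lemma two_part_sub (t t' : {set V}) :
  t' \in two_part_faces -> t \subset t' -> t \in two_part_faces.
Proof.
rewrite !inE => /andP[a b] tt'.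
by apply/andP; split; [apply: contra a|apply: contra b] => /subset_trans; apply.
Qed.

Hypotheses (A0 : A != set0) (B0 : ~: A != set0).

Lemma two_part0 : set0 \in two_part_faces.
Proof. by rewrite inE !subset0 A0 B0. Qed.

Definition two_part : complex V := Complex two_part0 two_part_sub.

End TwoPart.

Lemma enum_complement (V : finType) (b : V) m : #|V| = m.+1 ->
  exists e : 'I_m -> V, [/\ injective e, forall i, e i != b &
    forall v, v != b -> exists i, v = e i].
Proof.
move=> cV; have cm : #|predC1 b| = m by rewrite cardC1 cV.
case: m / cm {cV}; exists enum_val; split=> [|i|v vb].
- exact: enum_val_inj.
- exact: (enum_valP i).
- have vP : v \in predC1 b by [].
  by exists (enum_rank_in vP v); rewrite enum_rankK_in.
Qed.

Section Spheres.
Variable R : realType.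
Local Notation point V := {ffun V -> R}.

(** Remove a vertex [b] outside [A] and star the face [A] of the boundary of the
    simplex on the other vertices: the apex of the star plays the role of [b].
    If the complement of [A] is [b] alone, then [A] is not a face and starring
    changes nothing, as it should. *)
Lemma two_part_subd (V : finType) (A : {set V}) (A0 : A != set0)
    (B0 : ~: A != set0) m : #|V| = m.+2 ->
  exists p : V -> point 'I_m.+1,
    subdivides (simplex_boundary m) (two_part A0 B0) p.
Proof.
move=> cV; have /set0Pn[b] := B0; rewrite inE => bA.
have [e [e_inj eb e_cod]] := enum_complement b cV.
pose A' := e @^-1: A.
pose x : point 'I_m.+1 := [ffun i => (i \in A')%:R / #|A'|%:R].
have A'0 : (0 < #|A'|)%N.
  have /set0Pn[a aA] := A0; have ab : a != b by apply: contraNneq bA => <-.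
  by have [i ai] := e_cod _ ab; apply/card_gt0P; exists i; rewrite inE -ai.
have sx : supp x = A'.
  apply/setP=> i; rewrite in_supp ffunE mulf_eq0 invr_eq0 !pnatr_eq0.
  by rewrite (gtn_eqF A'0) orbF eqb0 negbK.
have s0 : supp x != set0 by rewrite sx -card_gt0.
have x0 i : 0 <= x i by rewrite ffunE divr_ge0 ?ler0n.
have mx : mass x = 1.
  rewrite /mass; under eq_bigr => i _ do rewrite ffunE.
  have e1 : (\sum_i (i \in A'))%N = #|A'|.
    rewrite -sum1_card [RHS]big_mkcond; apply: eq_bigr => i _.
    by case: (i \in A').
  by rewrite -mulr_suml -natr_sum e1 divff // pnatr_eq0 -lt0n.
have S := stellar_subd (simplex_boundary m) s0 x0 mx.
pose psi o := if o is Some i then e i else b.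
suff [p Hp] : exists p : V -> point (option 'I_m.+1),
    subdivides (stellar (simplex_boundary m) s0) (two_part A0 B0) p.
  by exists (fun v => barycenter (stellar_pos x) (p v)); apply: subd_trans S Hp.
have psi_inj : injective psi.
  move=> [i|] [j|] //=; first by move/e_inj->.
    by move/eqP; rewrite (negPf (eb _)).
  by move/esym/eqP; rewrite (negPf (eb _)).
apply: (@subd_relabel R _ _ (two_part A0 B0) (stellar _ s0) psi psi_inj)
  => [T|v _];
  last first.
  have [->|/e_cod[i ->]] := eqVneq v b; first by exists None.
  by exists (Some i).
have eT i : (e i \in psi @: T) = (i \in Some @^-1: T).
  by rewrite inE -(mem_imset _ _ psi_inj).
have bT : (b \in psi @: T) = (None \in T) by rewrite -(mem_imset _ _ psi_inj).
have sub1 : (A \subset psi @: T) = (A' \subset Some @^-1: T).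
  apply/subsetP/subsetP => h i; first by rewrite inE -eT => /h.
  move=> iA; have ib : i != b by apply: contraNneq bA => <-.
  by have [j ij] := e_cod _ ib; rewrite ij eT h // inE -ij.
rewrite !inE sub1 sx; have [//|nA] := boolP (A' \subset _) => /=.
rewrite properEneq subsetT andbT; congr (~~ _).
apply/subsetP/eqP => [h|/setP h v].
  have bT' : None \in T by rewrite -bT h // inE.
  apply/setP=> i; rewrite bT' in_setU in_setT.
  have [//|iA] := boolP (i \in A'); rewrite -eT h //.
  by move: iA; rewrite !inE.
have bT' : None \in T.
  apply: contraNT nA => nT; apply/subsetP=> i _.
  by have := h i; rewrite (negPf nT) in_setU in_set0 in_setT.
rewrite inE => vA; have [->|/e_cod[i vi]] := eqVneq v b; first by rewrite bT.
move: vA; rewrite vi eT => iA; have := h i.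
by rewrite bT' in_setU in_setT [i \in A']inE (negPf iA).
Qed.

(** As in [simplex_boundary], the dimension is [m - 1]. *)
Definition sphere (m : nat) (V : finType) (K : complex V) : Prop :=
  PL_equiv R K (simplex_boundary m).

Lemma sphere_subd m (V W : finType) (K : complex V) (L : complex W)
    (p : V -> point W) :
  subdivides L K p -> sphere m K -> sphere m L.
Proof.
move=> LK [U [P [a [b [KP SP]]]]].
exists U, P, (fun u => barycenter p (a u)), b.
by split=> //; apply: subd_trans LK KP.
Qed.

Lemma sphere_eq m (V : finType) (K L : complex V) :
  K =i L -> sphere m K -> sphere m L.
Proof.
move=> KL; have [|t|w _|p LK] := @subd_relabel R _ _ K L id.
- exact: inj_id.
- by rewrite imset_id KL.
- by exists w.
- exact: sphere_subd LK.
Qed.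

(** With a common subdivision refined so that its vertex [w'] over [v] is also
    the apex of a stellar subdivision of the simplex boundary, the link of [w']
    is a common subdivision of the two links. *)
Lemma sphere_link_vertex m (V : finType) (K : complex V) v
    (vK : [set v] \in K) : sphere m K ->
  exists2 m', m = m'.+1 & sphere m' (link vK).
Proof.
move=> [U [P [p [q [KP SP]]]]].
have [w wP pw] := subd_over_vertex KP vK.
have s0 : supp (q w) != set0.
  by apply/set0Pn/mass_supp; rewrite (subd_mass1 SP wP) oner_eq0.
have /coneP[_ sK] := subd_vertex SP wP; have := sK; rewrite inE => sp.
have c0 : ~: supp (q w) != set0.
  by apply: contraTneq sp => e; rewrite -(setCK (supp _)) e setC0 properxx.
have m0 : (0 < m)%N.
  move: s0; rewrite -card_gt0 => /leq_ltn_trans/(_ (proper_card sp)).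
  by rewrite cardsT card_ord.
exists m.-1; first by rewrite prednK.
have [W [P' [r [q' [w' [PP' SP' w'P rw' qw']]]]]] :=
  subd_stellar_vertex SP wP s0.
have KP' := subd_trans KP PP'.
have pw' : barycenter p (r w') = delta R v by rewrite rw' bary_delta.
have L1 := subd_link_vertex vK w'P KP' pw'.
have L2 := subd_link_vertex (stellar_apex s0 sK) w'P SP' qw'.
have [p2 H2] : exists p2 : option 'I_m.+1 -> point 'I_m.+1,
    subdivides (two_part s0 c0) (link (stellar_apex s0 sK)) p2.
  apply: (@subd_relabel R _ _ (link _) (two_part s0 c0) Some Some_inj) => [t|].
    have SomeK : Some @^-1: ([set None] :|: [set Some x | x in t]) = t.
      by apply/setP=> x; rewrite !inE /= mem_imset //; apply: Some_inj.
    rewrite !inE SomeK eqxx /= disjoints1.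
    have -> : (None \notin [set Some x | x in t]) by apply/imsetP => -[].
    rewrite andTb properEneq subsetT andbT; congr (_ && ~~ _).
    apply/eqP/subsetP => [/setP h x|h].
      by have := h x; rewrite !inE; case: eqP.
    apply/setP=> x; rewrite in_setU in_setT.
    case: (boolP (x \in supp _)) => //= xs.
    by apply: h; rewrite inE.
  move=> [x|]; first by exists x.
  by rewrite inE disjoints1 inE eqxx.
have [p3 H3] : exists p3 : 'I_m.+1 -> point 'I_m.-1.+1,
    subdivides (simplex_boundary m.-1) (two_part s0 c0) p3.
  by apply: two_part_subd; rewrite card_ord prednK.
do 4!eexists; split; first exact: L1.
exact: subd_trans H3 (subd_trans H2 L2).
Qed.

(** By induction, since links of vertices in links are links. *)
Lemma sphere_link m (V : finType) (K : complex V) (s : {set V})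
    (sK : s \in K) : sphere m K ->
  (#|s| <= m)%N /\ sphere (m - #|s|) (link sK).
Proof.
have [n] := ubnP #|s|; elim: n s sK => // n IH s sK; rewrite ltnS => sn mK.
have [s0|[v vs]] := set_0Vmem s.
  subst s; rewrite cards0 subn0; split=> //; apply: sphere_eq mK => t.
  by rewrite inE set0U -setI_eq0 set0I eqxx.
have s'K : s :\ v \in K by apply: face_sub sK _; apply: subsetDl.
move: sn; rewrite (cardsD1 v) vs add1n => sn.
have [s'm] := IH _ s'K sn mK.
have vL : [set v] \in link s'K.
  by rewrite inE disjoint_sym disjoints1 !inE eqxx setUC setD1K.
case/(sphere_link_vertex vL) => m' em' m'L.
split; first by rewrite -subn_gt0 em'.
rewrite subnS em' /=; apply: sphere_eq m'L => t.
have d : [disjoint s & t] = (v \notin t) && [disjoint s :\ v & t].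
  by rewrite -{1}(setD1K vs) -setI_eq0 setIUl setU_eq0 !setI_eq0 disjoints1.
have d' : [disjoint s :\ v & v |: t] = [disjoint s :\ v & t].
  rewrite -!setI_eq0 setIUr setU_eq0 [X in X && _](_ : _ = true) //.
  by rewrite setI_eq0 disjoint_sym disjoints1 !inE eqxx.
have u : (s :\ v) :|: (v |: t) = s :|: t.
  by rewrite setUA [_ :|: [set v]]setUC setD1K.
have mem (X : {set V}) (XK : X \in K) (Y : {set V}) :
    (Y \in link XK) = [disjoint X & Y] && (X :|: Y \in K) by rewrite inE.
by rewrite mem d -u -d' -andbA -mem inE disjoints1.
Qed.

End Spheres.

(** * Joins *)

Section Join.
Variables (V W : finType) (K : complex V) (L : complex W).

Definition join_faces : {set {set V + W}} :=
  [set t : {set V + W} | inl @^-1: t \in K & inr @^-1: t \in L].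

Lemma join_face0 : set0 \in join_faces.
Proof. by rewrite inE !preimset0 !face0. Qed.

Lemma join_face_sub (t t' : {set V + W}) :
  t' \in join_faces -> t \subset t' -> t \in join_faces.
Proof.
rewrite !inE => /andP[k l] tt'.
by rewrite (face_sub k) ?(face_sub l) // preimsetS.
Qed.

Definition join : complex (V + W)%type := Complex join_face0 join_face_sub.

End Join.

Section BigJoin.
Variables (V I : finType) (K : I -> complex V).

Definition slice (t : {set V * I}) i : {set V} := [set x | (x, i) \in t].

Definition bigjoin_faces : {set {set V * I}} :=
  [set t : {set V * I} | [forall i, slice t i \in K i]].

Lemma bigjoin_face0 : set0 \in bigjoin_faces.
Proof.
rewrite inE; apply/forallP => i; rewrite (_ : slice _ _ = set0) ?face0 //.
by apply/setP=> x; rewrite !inE.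
Qed.

Lemma bigjoin_face_sub (t t' : {set V * I}) :
  t' \in bigjoin_faces -> t \subset t' -> t \in bigjoin_faces.
Proof.
rewrite !inE => /forallP h tt'; apply/forallP=> i; apply: face_sub (h i) _.
by apply/subsetP=> x; rewrite !inE; apply: (subsetP tt').
Qed.

Definition bigjoin : complex (V * I)%type :=
  Complex bigjoin_face0 bigjoin_face_sub.

Lemma bigjoinP t : reflect (forall i, slice t i \in K i) (t \in bigjoin).
Proof. by rewrite inE; apply: forallP. Qed.

End BigJoin.

Section SphereJoin.
Variable R : realType.
Local Notation point V := {ffun V -> R}.

Definition lpart (V W : finType) (t : point (V + W)%type) : point V :=
  [ffun v => t (inl v)].
Definition rpart (V W : finType) (t : point (V + W)%type) : point W :=
  [ffun w => t (inr w)].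

Definition join_pos (U1 U2 V W : finType) (p : U1 -> point V)
    (q : U2 -> point W) (u : U1 + U2) : point (V + W)%type :=
  [ffun z => match u, z with
    | inl a, inl v => p a v
    | inr b, inr w => q b w
    | _, _ => 0 end].

Lemma cone_join (V W : finType) (K : complex V) (L : complex W) t :
  (t \in cone (join K L)) = (lpart t \in cone K) && (rpart t \in cone L).
Proof.
have sl : supp (lpart t) = inl @^-1: supp t.
  by apply/setP=> v; rewrite !inE ffunE.
have sr : supp (rpart t) = inr @^-1: supp t.
  by apply/setP=> v; rewrite !inE ffunE.
apply/coneP/andP => [[t0]|[/coneP[a b] /coneP[c d]]].
  rewrite inE => /andP[k l]; split; apply/coneP; rewrite ?sl ?sr;
    by split=> // v; rewrite ffunE.
split; last by rewrite inE -sl -sr b d.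
by case=> v; [have := a v|have := c v]; rewrite ffunE.
Qed.

Lemma lpart_bary (U1 U2 V W : finType) (p : U1 -> point V)
    (q : U2 -> point W) t :
  lpart (barycenter (join_pos p q) t) = barycenter p (lpart t).
Proof.
apply/ffunP=> v; rewrite ffunE !baryE big_sumType /= addrC big1 ?add0r.
  by apply: eq_bigr => u _; rewrite !ffunE.
by move=> u _; rewrite ffunE mulr0.
Qed.

Lemma rpart_bary (U1 U2 V W : finType) (p : U1 -> point V)
    (q : U2 -> point W) t :
  rpart (barycenter (join_pos p q) t) = barycenter q (rpart t).
Proof.
apply/ffunP=> v; rewrite ffunE !baryE big_sumType /= big1 ?add0r.
  by apply: eq_bigr => u _; rewrite !ffunE.
by move=> u _; rewrite ffunE mulr0.
Qed.

Lemma parts_inj (V W : finType) (t t' : point (V + W)%type) :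
  lpart t = lpart t' -> rpart t = rpart t' -> t = t'.
Proof.
move=> /ffunP l /ffunP r; apply/ffunP=> -[v|w].
  by have := l v; rewrite !ffunE.
by have := r w; rewrite !ffunE.
Qed.

Lemma subd_join (U1 U2 V W : finType) (K : complex V) (L : complex W)
    (P : complex U1) (Q : complex U2) p q :
  subdivides K P p -> subdivides L Q q ->
  subdivides (join K L) (join P Q) (join_pos p q).
Proof.
move=> KP LQ; split.
- move=> [u|u]; rewrite inE /mass big_sumType /= => /andP[uP uQ].
    rewrite addrC big1 ?add0r => [|w _]; last by rewrite ffunE.
    under eq_bigr => v _ do rewrite ffunE.
    by apply: (subd_mass1 KP); apply: supp_vertex uP _; rewrite !inE.
  rewrite big1 ?add0r => [|w _]; last by rewrite ffunE.
  under eq_bigr => v _ do rewrite ffunE.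
  by apply: (subd_mass1 LQ); apply: supp_vertex uQ _; rewrite !inE.
- move=> t; rewrite !cone_join lpart_bary rpart_bary => /andP[l r].
  by rewrite (subd_cone KP) ?(subd_cone LQ).
- move=> t t'; rewrite !cone_join => /andP[l r] /andP[l' r'] e.
  apply: parts_inj; [apply: (subd_inj KP)|apply: (subd_inj LQ)] => //.
    by rewrite -!(lpart_bary p q) e.
  by rewrite -!(rpart_bary p q) e.
- move=> y; rewrite cone_join => /andP[/(subd_surj KP)[a aP ea]].
  case/(subd_surj LQ) => b bQ eb.
  pose t : point (U1 + U2)%type :=
    [ffun u => match u with inl u => a u | inr u => b u end].
  have ta : lpart t = a by apply/ffunP=> u; rewrite !ffunE.
  have tb : rpart t = b by apply/ffunP=> u; rewrite !ffunE.
  exists t; first by rewrite cone_join ta tb aP.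
  by apply: parts_inj; rewrite ?lpart_bary ?rpart_bary ?ta ?tb.
Qed.

(** Joining common subdivisions gives a common subdivision of the join and of
    the join of two simplex boundaries, which is a complex as in
    [two_part_subd]. *)
Lemma sphere_join m l (V W : finType) (K : complex V) (L : complex W) :
  sphere R m K -> sphere R l L -> sphere R (m + l) (join K L).
Proof.
move=> [U1 [P [p1 [p2 [KP SP]]]]] [U2 [Q [q1 [q2 [LQ SQ]]]]].
pose A : {set 'I_m.+1 + 'I_l.+1} :=
  [set z | if z is inl _ then true else false].
have A0 : A != set0 by apply/set0Pn; exists (inl ord0); rewrite inE.
have B0 : ~: A != set0 by apply/set0Pn; exists (inr ord0); rewrite !inE.
have [|a Ha] := @two_part_subd R _ A A0 B0 (m + l).
  by rewrite card_sum !card_ord addSn addnS.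
have [|t|z _|b Hb] := @subd_relabel R _ _
    (join (simplex_boundary m) (simplex_boundary l)) (two_part A0 B0) id.
- exact: inj_id.
- rewrite imset_id !inE !properEneq !subsetT !andbT.
  congr (~~ _ && ~~ _); apply/eqP/subsetP => [/setP h [i|i]|h];
    try (by rewrite !inE); try (by have := h i; rewrite !inE);
    by apply/setP=> i; rewrite in_setT inE; apply: h; rewrite !inE.
- by exists z.
exists _, (join P Q), (join_pos p1 q1).
eexists; split; first exact: subd_join.
exact: subd_trans Ha (subd_trans Hb (subd_join SP SQ)).
Qed.

Lemma sphere_bigjoin n (V : finType) (K : 'I_n -> complex V) (d : 'I_n -> nat) :
  (forall i, sphere R (d i) (K i)) -> sphere R (\sum_i d i) (bigjoin K).
Proof.
elim: n K d => [|n IH] K d Kd.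
  rewrite big_ord0.
  have empty (z : V * 'I_0) : False by case: z => x [].
  have [|t|w|p Hp] := @subd_relabel R _ _ (simplex_boundary 0) (bigjoin K)
      (fun _ => ord0).
  - by move=> z; case: (empty z).
  - have -> : t = set0 by apply/setP=> z; case: (empty z).
    by rewrite imset0 !face0.
  - rewrite inE properEneq => /andP[/eqP[]].
    by apply/setP=> i; rewrite !inE !ord1 eqxx.
  apply: sphere_subd Hp _; exists _, (simplex_boundary 0).
  by do 2!eexists; split; apply: subd_refl.
pose psi (z : V * 'I_n.+1) : V + V * 'I_n :=
  if unlift ord0 z.2 is Some j then inr (z.1, j) else inl z.1.
have psi0 x : psi (x, ord0) = inl x by rewrite /psi unlift_none.
have psiS x j : psi (x, lift ord0 j) = inr (x, j) by rewrite /psi liftK.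
have psi_inj : injective psi.
  by move=> [x i] [y j]; case: (unliftP ord0 i) => [i'|] ->;
    case: (unliftP ord0 j) => [j'|] ->; rewrite ?psi0 ?psiS // => -[-> // ->].
rewrite big_ord_recl.
have J := sphere_join (Kd ord0) (IH _ _ (fun j => Kd (lift ord0 j))).
have [t|w _|p Hp] := @subd_relabel R _ _
  (join (K ord0) (bigjoin (fun j => K (lift ord0 j)))) (bigjoin K) psi psi_inj.
- have e0 : inl @^-1: (psi @: t) = slice t ord0.
    by apply/setP=> x; rewrite !inE -psi0 mem_imset.
  have eS j : slice (inr @^-1: (psi @: t)) j = slice t (lift ord0 j).
    by apply/setP=> x; rewrite !inE -psiS mem_imset.
  rewrite inE e0; apply/andP/bigjoinP => [[h0 /bigjoinP hS] i|h].
    by case: (unliftP ord0 i) => [j|] -> //; rewrite -eS.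
  by split=> //; apply/bigjoinP => j; rewrite eS.
- by case: w => [x|[x j]]; [exists (x, ord0)|exists (x, lift ord0 j)].
exact: sphere_subd Hp J.
Qed.

End SphereJoin.

(** * Links in Hom complexes *)

Section Independence.
Variable G : sgraph.

Definition independent_sets : {set {set G}} :=
  [set s : {set G} | [forall x in s, forall y in s, ~~ adj x y]].

Lemma indP (s : {set G}) :
  reflect {in s &, forall x y, ~~ adj x y} (s \in independent_sets).
Proof.
rewrite inE; apply: (iffP forall_inP) => [h x y xs ys|h x xs].
  by have /forall_inP := h _ xs; apply.
by apply/forall_inP => y ys; apply: h.
Qed.

Lemma ind0 : set0 \in independent_sets.
Proof. by apply/indP=> x; rewrite inE. Qed.

Lemma ind_sub (s t : {set G}) :
  t \in independent_sets -> s \subset t -> s \in independent_sets.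
Proof.
by move=> /indP h /subsetP st; apply/indP=> x y /st xt /st yt; apply: h.
Qed.

Definition Ind : complex G := Complex ind0 ind_sub.

Lemma Ind_flag : flag Ind.
Proof.
move=> s _ h; apply/indP => x y xs ys.
have [->|xy] := eqVneq x y; first by rewrite adj_irr.
by have /indP := h _ _ xs ys xy; apply; rewrite !inE eqxx ?orbT.
Qed.

Lemma Ind_pair x y : x != y -> ([set x; y] \in Ind) = ~~ adj x y.
Proof.
move=> xy; apply/indP/idP => [|nxy u v].
  by apply; rewrite !inE eqxx ?orbT.
by rewrite !inE => /orP[]/eqP-> /orP[]/eqP->; rewrite ?adj_irr // adj_sym.
Qed.

Lemma Ind_vertex (x : G) : [set x] \in Ind.
Proof. by apply/indP=> u v; rewrite !inE => /eqP-> /eqP->; rewrite adj_irr. Qed.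

Lemma graph_iso_Ind : graph_iso G (complement (skeleton1 Ind)).
Proof.
exists (fun x => Sub x (Ind_vertex x) : skeleton1 Ind) => [|x y].
  by exists val => [x|u] //; apply: val_inj.
rewrite /= /compl_rel /= /skeleton_rel /= -!val_eqE /=.
have [->|xy] := eqVneq x y; first by rewrite adj_irr.
by rewrite Ind_pair //= negbK.
Qed.

(** A flag complex is determined by its 1-skeleton. *)
Lemma Ind_subd (R : realType) (W : finType) (K : complex W) : flag K ->
  graph_iso G (complement (skeleton1 K)) ->
  exists p : W -> {ffun G -> R}, subdivides Ind K p.
Proof.
move=> flK [phi [phi' phiK phi'K] adjE].
pose psi x : W := val (phi x).
have psi_inj : injective psi by move=> x y /val_inj/(can_inj phiK).
apply: (@subd_relabel R _ _ K Ind psi psi_inj) => [t|w wK]; last first.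
  by exists (phi' (Sub w wK)); rewrite /psi phi'K SubK.
have adjN x y : x != y -> ([set psi x; psi y] \in K) = ~~ adj x y.
  move=> xy; rewrite -adjE /= /compl_rel /= /skeleton_rel.
  by rewrite (can_eq phiK) xy negbK.
apply/idP/indP => [tK x y xt yt|h].
  have [->|xy] := eqVneq x y; first by rewrite adj_irr.
  rewrite -adjN //; apply: face_sub tK _.
  by apply/subsetP=> w; rewrite !inE => /orP[]/eqP->; rewrite imset_f.
apply: flK => [w /imsetP[x _ ->]|w w' /imsetP[x xt ->] /imsetP[y yt ->]].
  exact: (valP (phi x)).
by rewrite (inj_eq psi_inj) => xy; rewrite adjN // h.
Qed.

End Independence.

Section HomLink.
Variables (G : sgraph) (n : nat) (f : {ffun G -> complete n}).
Hypothesis fh : is_hom f.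

Lemma homP x y : adj x y -> f x != f y.
Proof. by move: fh => /forallP/(_ x)/forallP/(_ y)/implyP. Qed.

Definition colour_class (i : 'I_n) : {set G} := [set x | f x == i].

Lemma colour_class_ind i : colour_class i \in Ind G.
Proof.
apply/indP=> x y; rewrite !inE => /eqP <- /eqP e.
by apply: contraT => /negPn/homP; rewrite e eqxx.
Qed.

Definition hom_link : complex (G * 'I_n)%type :=
  bigjoin (fun i => link (colour_class_ind i)).

Lemma hom_linkP t : t \in hom_link ->
  (forall x i, (x, i) \in t -> f x != i) /\
  (forall i, colour_class i :|: slice t i \in Ind G).
Proof.
move=> /bigjoinP h; split=> [x i xt|i]; have := h i; rewrite inE => /andP[d //].
move=> _; apply: contraL d => fx; rewrite -setI_eq0; apply/set0Pn; exists x.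
by rewrite !inE fx.
Qed.

(** The face [t] of the join stands for the cell in which [x] has, besides its
    own colour, the colours [i] with [(x, i)] in [t]. *)
Lemma hom_link_is_link : is_link f hom_link.
Proof.
pose F (t : {set G * 'I_n}) : {ffun G -> {set complete n}} :=
  [ffun x => f x |: [set i | (x, i) \in t]].
have FE t x i : (i \in F t x) = (i == f x) || ((x, i) \in t).
  by rewrite ffunE !inE.
exists F; split.
- move=> s /hom_linkP[sf si] /set0Pn[[x i] xs]; split.
    rewrite inE; apply/andP; split.
      by apply/forallP=> y; apply/set0Pn; exists (f y); rewrite FE eqxx.
    apply/forallP=> u; apply/forallP=> v; apply/implyP=> uv.
    apply/forall_inP=> a au; apply/forall_inP=> b bv.
    rewrite /= /complete_rel; apply/eqP=> ab; subst b.
    suff : ~~ adj u v by rewrite uv.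
    apply: (indP _ (si a)).
      by move: au; rewrite FE !inE eq_sym.
    by move: bv; rewrite FE !inE eq_sym.
  apply/andP; split.
    by apply/forallP=> y; rewrite ffunE sub1set FE eqxx.
  apply/eqP=> /ffunP/(_ x)/setP/(_ i); rewrite FE xs orbT ffunE inE.
  by rewrite eq_sym (negPf (sf _ _ xs)).
- move=> s t /hom_linkP[sf _] _ _ _; apply/forallP/subsetP => [h [x i] xs|h x].
    have /subsetP/(_ i) := h x; rewrite !FE xs orbT.
    by rewrite eq_sym (negPf (sf _ _ xs)); apply.
  by apply/subsetP=> i; rewrite !FE => /orP[->//|/h->]; rewrite orbT.
- move=> eta; rewrite inE => /andP[_ /forallP eh] /andP[/forallP le ne].
  have fe x : f x \in eta x by have := le x; rewrite ffunE sub1set.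
  pose s := [set z : G * 'I_n | (z.2 \in eta z.1) && (f z.1 != z.2)].
  have Fs : F s = eta.
    apply/ffunP=> x; apply/setP=> i; rewrite FE inE /= eq_sym.
    by have [<-|_] := eqVneq (f x) i; rewrite ?fe // andbT.
  exists s; split=> //.
    apply/bigjoinP=> i; rewrite inE; apply/andP; split.
      rewrite -setI_eq0; apply/eqP/setP=> x.
      by rewrite !inE /= andbCA andbN andbF.
    apply/indP=> x y.
    have mem z : z \in colour_class i :|: slice s i -> i \in eta z.
      by rewrite !inE /= => /orP[/eqP<-|/andP[]].
    move=> /mem ix /mem iy; apply/negP=> xy.
    have := eh x => /forallP/(_ y)/implyP/(_ xy)/forall_inP/(_ i ix).
    move=> /forall_inP/(_ i iy).
    by rewrite /= /complete_rel eqxx.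
  apply: contra ne => /eqP s0; rewrite -Fs s0; apply/eqP/ffunP=> x.
  by apply/setP=> i; rewrite FE ffunE !inE orbF.
Qed.

Lemma colour_class_card : (\sum_(i < n) #|colour_class i|)%N = #|G|.
Proof.
rewrite -sum1_card (partition_big (fun x => f x : 'I_n) predT) //=.
apply: eq_bigr => i _; rewrite sum1dep_card.
by apply: eq_card => x; rewrite !inE.
Qed.

Lemma sphere_hom_link (R : realType) m : sphere R m (Ind G) ->
  sphere R (n * m - #|G|) hom_link.
Proof.
move=> IG; have L i := sphere_link (colour_class_ind i) IG.
have -> : (n * m - #|G| = \sum_(i < n) (m - #|colour_class i|))%N.
  rewrite sumnB => [|i _]; last by case: (L i).
  by rewrite colour_class_card sum_nat_const card_ord.
by apply: sphere_bigjoin => i; case: (L i).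
Qed.

End HomLink.

(** Both face posets are isomorphic to the poset of cells above [f]. *)
Lemma is_link_unique (R : realType) (G H : sgraph) (f : {ffun G -> H})
    (V W : finType) (K : complex V) (L : complex W) :
  is_link f K -> is_link f L ->
  exists p : W -> {ffun V -> R}, subdivides K L p.
Proof.
move=> [F [F1 F2 F3]] [E [E1 E2 E3]].
pose Phi s := odflt set0 [pick t | [&& t \in K, t != set0 & F t == E s]].
have PhiP s : s \in L -> s != set0 ->
    [/\ Phi s \in K, Phi s != set0 & F (Phi s) = E s].
  move=> sL s0; rewrite /Phi; case: pickP => [t /and3P[a b /eqP]//|none].
  have [hom lt] := E1 _ sL s0; have [t [tK t0 e]] := F3 _ hom lt.
  by have := none t; rewrite tK t0 e eqxx.
apply: (@subd_poset_iso R _ _ L K Phi) => [s sL s0|s t sL s0 tL t0|t tK t0].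
- by have [] := PhiP _ sL s0.
- have [a b e] := PhiP _ sL s0; have [a' b' e'] := PhiP _ tL t0.
  by rewrite -F2 // e e' E2.
- have [hom lt] := F1 _ tK t0; have [s [sL s0 e]] := E3 _ hom lt.
  exists s; split=> //; have [a b e'] := PhiP _ sL s0.
  by apply/eqP; rewrite eqEsubset -!F2 // e' e; apply/andP; split;
    apply/forallP=> x.
Qed.

Lemma chromatic_number_le (G : sgraph) n :
  colorable G n -> (chromatic_number G <= n)%N.
Proof. by rewrite /chromatic_number; case: ex_minnP => k _; apply. Qed.

(** In the link of a largest face without the colour [c], only vertices with
    colour [c] remain, and these form a copy of Ind(G). *)
Lemma sphere_Ind_of_hom_link (R : realType) (G : sgraph) n
    (f : {ffun G -> complete n}) (fh : is_hom f) (c : 'I_n) d :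
  (forall x, f x != c) -> sphere R d (hom_link fh) ->
  exists m, sphere R m (Ind G).
Proof.
move=> fc Sd; pose avoids (t : {set G * 'I_n}) :=
  (t \in hom_link fh) && (slice t c == set0).
have av0 : avoids set0.
  by rewrite /avoids face0; apply/eqP/setP=> x; rewrite !inE.
case: (arg_maxnP (fun t : {set G * 'I_n} => #|t|) av0)
  => s /andP[sJ /eqP sc] smax.
have [_ Ss] := sphere_link sJ Sd.
have c0 : colour_class f c = set0.
  by apply/setP=> x; rewrite !inE (negPf (fc x)).
have sc' x : (x, c) \notin s by move/setP/(_ x): sc; rewrite !inE => ->.
exists (d - #|s|)%N; pose psi (x : G) := (x, c).
have psi_inj : injective psi by move=> x y [].
have [t|[x i]|p Hp] := @subd_relabel R _ _ (link sJ) (Ind G) psi psi_inj;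
  last exact: sphere_subd Hp Ss.
- have slc : slice (s :|: psi @: t) c = t.
    apply/setP=> x; rewrite !inE (negPf (sc' x)) orFb -[(x, c)]/(psi x).
    by rewrite mem_imset.
  have sli i : i != c -> slice (s :|: psi @: t) i = slice s i.
    move=> ic; apply/setP=> x; rewrite !inE; case: (boolP (_ \in psi @: t)).
      by case/imsetP=> y _ [_ e]; rewrite e eqxx in ic.
    by rewrite orbF.
  rewrite inE; apply/andP/idP => [[_ /bigjoinP/(_ c)]|tI].
    by rewrite slc inE c0 set0U => /andP[].
  split.
    rewrite disjoint_sym; apply/pred0P => z /=.
    apply/negP => /andP[/imsetP[x _ ->]].
    by rewrite (negPf (sc' x)).
  apply/bigjoinP=> i; have [->|ic] := eqVneq i c; last first.
    by rewrite sli //; apply: (bigjoinP _ _ sJ).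
  by rewrite slc inE c0 set0U tI -setI_eq0 set0I eqxx.
- rewrite inE disjoint_sym disjoints1 => /andP[xs xJ].
  have [->|ic] := eqVneq i c; first by exists x.
  have /smax : avoids (s :|: [set (x, i)]).
    rewrite /avoids xJ; apply/eqP/setP=> y; rewrite !inE (negPf (sc' y)) /=.
    by apply/eqP => -[_ e]; rewrite e eqxx in ic.
  by rewrite setUC cardsU1 xs /= add1n ltnn.
Qed.

Theorem theorem6 (R : realType) (G : sgraph) :
  (forall n : nat, (chromatic_number G <= n)%N ->
     Hom_PL_manifold R G (complete n)) <->
  (exists (W : finType) (K : complex W),
     [/\ flag K, PL_sphere R K & graph_iso G (complement (skeleton1 K))]).
Proof.
split=> [man|[W [K [flK [m /PL_homeomorphicP SK] iso]]] n _]; last first.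
  have [p IK] := Ind_subd R flK iso; have IG := sphere_subd IK SK.
  exists (n * m - #|G|)%N => f fh; exists _, (hom_link fh).
  split; first exact: hom_link_is_link.
  exact/PL_homeomorphicP/sphere_hom_link.
(* This colouring leaves the last colour unused. *)
pose f : {ffun G -> complete #|G|.+1} :=
  [ffun x => widen_ord (leqnSn _) (enum_rank x)].
have fh : is_hom f.
  apply/forallP=> x; apply/forallP=> y; apply/implyP=> xy.
  rewrite /= /complete_rel !ffunE -val_eqE /=; apply/eqP=> e.
  by move/val_inj/enum_rank_inj: e xy => ->; rewrite adj_irr.
have [|d Md] := man #|G|.+1.
  by apply: chromatic_number_le; apply/existsP; exists f.
have [W [L [fL /PL_homeomorphicP SL]]] := Md f fh.
have [p JL] := is_link_unique R (hom_link_is_link fh) fL.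
have [|m IG] :=
  @sphere_Ind_of_hom_link R _ _ _ fh ord_max d _ (sphere_subd JL SL).
  by move=> x; rewrite ffunE -val_eqE /= neq_ltn ltn_ord.
exists _, (Ind G); split; [exact: Ind_flag| |exact: graph_iso_Ind].
by exists m; apply/PL_homeomorphicP.
Qed.
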